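(* Let $n\ge 1$, let $\sigma=\{\sigma_1,\dots,\sigma_n\}$, and let $k$ be a $\sigma$-field. Let $A$ be a finitely $\sigma$-generated $k$-$\sigma$-Hopf algebra and let $B$ be a $k$-$\sigma$-Hopf subalgebra of $A$. Then $B$ is finitely $\sigma$-generated over $k$ (as a $k$-$\sigma$-algebra).
   Context: All rings are commutative with unit; $\mathbb{N}=\{0,1,2,\dots\}$. A $\sigma$-ring is a ring $R$ with $n$ pairwise commuting ring endomorphisms $\sigma_1,\dots,\sigma_n$; a $\sigma$-field is a $\sigma$-ring whose underlying ring is a field. A morphism of $\sigma$-rings is a ring morphism commuting with each $\sigma_j$. $T_\sigma$ is the free commutative monoid of formal monomials $\tau=\sigma_1^{k_1}\cdots\sigma_n^{k_n}$, acting on every $\sigma$-ring. A $k$-$\sigma$-algebra is a $\sigma$-ring $R$ that is a $k$-algebra via a morphism $k\to R$ of $\sigma$-rings; it is finitely $\sigma$-generated if it is generated as a $k$-algebra by $\{\tau(f)\mid\tau\in T_\sigma,f\in F\}$ for some finite $F\subseteq R$. The tensor product of $k$-$\sigma$-algebras is a $k$-$\sigma$-algebra via $\sigma_j(r\otimes s)=\sigma_j(r)\otimes\sigma_j(s)$. A $k$-$\sigma$-Hopf algebra is a (commutative) $k$-Hopf algebra $A$ that is also a $k$-$\sigma$-algebra such that the comultiplication $A\to A\otimes_kA$, antipode $A\to A$ and counit $A\to k$ are morphisms of $k$-$\sigma$-algebras. A $k$-$\sigma$-Hopf subalgebra is a $k$-Hopf subalgebra that is closed under all $\sigma_j$. 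*)

(* Defs.v *)
From HB Require Import structures.
From mathcomp Require Import all_boot all_algebra generic_quotient.
From mathcomp Require Import all_classical.

Set Implicit Arguments.
Unset Strict Implicit.
Unset Printing Implicit Defensive.

Import GRing.Theory.
Local Open Scope quotient_scope.
Local Open Scope classical_set_scope.
Local Open Scope ring_scope.

Reserved Notation "u *t v" (at level 40, left associativity).

Section TensorDef.
Variables (k : fieldType) (U V : lmodType k).

(* A list [:: (u1, v1); ...; (um, vm)] stands for the formal sum of the
   ui (x) vi; the tensor product is the free commutative monoid of formal sums
   modulo the congruence below. *)
Inductive tensor_eq : seq (U * V) -> seq (U * V) -> Prop :=
| Tensor_refl s : tensor_eq s s
| Tensor_sym s t : tensor_eq s t -> tensor_eq t s
| Tensor_trans s t r : tensor_eq s t -> tensor_eq t r -> tensor_eq s r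
| Tensor_cat s t s' t' :
    tensor_eq s s' -> tensor_eq t t' -> tensor_eq (s ++ t) (s' ++ t')
| Tensor_catC s t : tensor_eq (s ++ t) (t ++ s)
| Tensor_zero v : tensor_eq [:: (0, v)] [::]
| Tensor_addl u u' v : tensor_eq [:: (u + u', v)] [:: (u, v); (u', v)]
| Tensor_addr u v v' : tensor_eq [:: (u, v + v')] [:: (u, v); (u, v')]
| Tensor_scale c u v : tensor_eq [:: (c *: u, v)] [:: (u, c *: v)].

Definition tensor_eqb s t := `[< tensor_eq s t >].

Fact tensor_eqb_refl : reflexive tensor_eqb.
Proof. by move=> s; apply/asboolP; constructor. Qed.

Fact tensor_eqb_sym : symmetric tensor_eqb.
Proof. by move=> s t; apply/asboolP/asboolP => st; apply: Tensor_sym. Qed.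

Fact tensor_eqb_trans : transitive tensor_eqb.
Proof.
by move=> t s r /asboolP st /asboolP tr; apply/asboolP; apply: Tensor_trans tr.
Qed.

Canonical tensor_equiv :=
  EquivRel tensor_eqb tensor_eqb_refl tensor_eqb_sym tensor_eqb_trans.

Definition tensor := {eq_quot tensor_equiv}.

HB.instance Definition _ := Choice.on tensor.
HB.instance Definition _ := EqQuotient.on tensor.

Definition tens (u : U) (v : V) : tensor := \pi_tensor [:: (u, v)].

Lemma tensor_piP s t : tensor_eq s t <-> \pi_tensor s = \pi_tensor t.
Proof.
split=> [st|/eqquotP/asboolP //].
by apply/eqquotP/asboolP.
Qed.

Lemma tensor_reprK s : tensor_eq (repr (\pi_tensor s)) s.
Proof. by apply/tensor_piP; rewrite reprK. Qed.

Lemma tensor_piW (P : tensor -> Prop) :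
  (forall s, P (\pi_tensor s)) -> forall t, P t.
Proof. by move=> Ppi t; rewrite -[t]reprK. Qed.

Definition tensor_zero : tensor := \pi_tensor [::].
Definition tensor_add (s t : tensor) : tensor := \pi_tensor (repr s ++ repr t).
Definition tensor_opp (s : tensor) : tensor :=
  \pi_tensor [seq (- p.1, p.2) | p <- repr s].

Fact tensor_pi_cat s t :
  \pi_tensor (s ++ t) = tensor_add (\pi_tensor s) (\pi_tensor t).
Proof.
by apply/tensor_piP/Tensor_cat; apply: Tensor_sym; apply: tensor_reprK.
Qed.

Fact tensor_addA : associative tensor_add.
Proof.
move=> x y z; elim/tensor_piW: x => s; elim/tensor_piW: y => t; elim/tensor_piW: z => r.
by rewrite -!tensor_pi_cat catA.
Qed.

Fact tensor_addC : commutative tensor_add.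
Proof.
move=> x y; elim/tensor_piW: x => s; elim/tensor_piW: y => t; rewrite -!tensor_pi_cat.
by apply/tensor_piP; constructor.
Qed.

Fact tensor_add0 : left_id tensor_zero tensor_add.
Proof. by move=> x; elim/tensor_piW: x => s; rewrite -tensor_pi_cat. Qed.

HB.instance Definition _ :=
  GRing.isNmodule.Build tensor tensor_addA tensor_addC tensor_add0.

Lemma tensor_piD s t : \pi_tensor (s ++ t) = \pi_tensor s + \pi_tensor t.
Proof. exact: tensor_pi_cat. Qed.

Lemma tensor_pi_sum s : \pi_tensor s = \sum_(p <- s) tens p.1 p.2.
Proof.
elim: s => [|[u v] s IHs]; first by rewrite big_nil.
by rewrite big_cons -IHs -cat1s tensor_piD.
Qed.

Lemma tensor_repr_sum t : t = \sum_(p <- repr t) tens p.1 p.2.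
Proof. by rewrite -tensor_pi_sum reprK. Qed.

Lemma tens0l v : tens 0 v = 0.
Proof. by apply/tensor_piP; constructor. Qed.

Lemma tensDl u u' v : tens (u + u') v = tens u v + tens u' v.
Proof. by rewrite /tens -tensor_piD; apply/tensor_piP; constructor. Qed.

Lemma tensDr u v v' : tens u (v + v') = tens u v + tens u v'.
Proof. by rewrite /tens -tensor_piD; apply/tensor_piP; constructor. Qed.

Lemma tensZ c u v : tens (c *: u) v = tens u (c *: v).
Proof. by apply/tensor_piP; constructor. Qed.

Lemma tens0r u : tens u 0 = 0.
Proof. by rewrite -(scale0r 0) -tensZ scale0r tens0l. Qed.

(* [tensor_lift f] is meaningful only for balanced f, see [tensor_liftE]. *)
Definition tensor_lift (W : nmodType) (f : U -> V -> W) (t : tensor) : W :=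
  \sum_(p <- repr t) f p.1 p.2.

Definition balanced (W : nmodType) (f : U -> V -> W) : Prop :=
  [/\ forall v, f 0 v = 0,
      forall u u' v, f (u + u') v = f u v + f u' v,
      forall u v v', f u (v + v') = f u v + f u v' &
      forall c u v, f (c *: u) v = f u (c *: v)].

Lemma tensor_lift_pi (W : nmodType) (f : U -> V -> W) s : balanced f ->
  tensor_lift f (\pi_tensor s) = \sum_(p <- s) f p.1 p.2.
Proof.
case=> f0 fDl fDr fZ; rewrite /tensor_lift.
move: (tensor_reprK s); move: (repr _) => t.
elim=> {s t} //=.
- by move=> s t r _ -> _.
- by move=> s t s' t' _ IHs _ IHt; rewrite !big_cat /= IHs IHt.
- by move=> s t; rewrite !big_cat /= addrC.
- by move=> v; rewrite big_seq1 big_nil f0.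
- by move=> u u' v; rewrite big_seq1 big_cons big_seq1 fDl.
- by move=> u v v'; rewrite big_seq1 big_cons big_seq1 fDr.
- by move=> c u v; rewrite !big_seq1 fZ.
Qed.

Lemma tensor_liftE (W : nmodType) (f : U -> V -> W) u v : balanced f ->
  tensor_lift f (tens u v) = f u v.
Proof. by move=> bf; rewrite tensor_lift_pi// big_seq1. Qed.

Lemma tensor_lift0 (W : nmodType) (f : U -> V -> W) : balanced f ->
  tensor_lift f 0 = 0.
Proof. by move=> bf; rewrite (tensor_lift_pi [::] bf) big_nil. Qed.

Lemma tensor_liftD (W : nmodType) (f : U -> V -> W) : balanced f ->
  {morph tensor_lift f : s t / s + t}.
Proof.
move=> bf; move=> x y; elim/tensor_piW: x => s; elim/tensor_piW: y => t.
by rewrite -tensor_piD !tensor_lift_pi// big_cat.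
Qed.

Lemma tensor_ind (P : tensor -> Prop) :
  P 0 -> (forall s t, P s -> P t -> P (s + t)) -> (forall u v, P (tens u v)) ->
  forall t, P t.
Proof.
by move=> P0 PD Pt t; rewrite (tensor_repr_sum t); elim/big_ind: _ => // p.
Qed.

Fact balanced_opp : balanced (fun u v => tens (- u) v).
Proof.
split=> [v|u u' v|u v v'|c u v]; first by rewrite oppr0 tens0l.
- by rewrite opprD tensDl.
- by rewrite tensDr.
- by rewrite -scalerN tensZ.
Qed.

Fact tensor_addN : left_inverse 0 (tensor_lift (fun u v => tens (- u) v)) +%R.
Proof.
elim/tensor_ind => [|s t IHs IHt|u v].
- by rewrite (tensor_lift0 balanced_opp) addr0.
- by rewrite (tensor_liftD balanced_opp) addrACA IHs IHt addr0.
- by rewrite (tensor_liftE _ _ balanced_opp) -tensDl addNr tens0l.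
Qed.

HB.instance Definition _ := GRing.Nmodule_isZmodule.Build tensor tensor_addN.

Definition tensor_scale (c : k) : tensor -> tensor :=
  tensor_lift (fun u v => tens (c *: u) v).

Fact balanced_scale c : balanced (fun u v => tens (c *: u) v).
Proof.
split=> [v|u u' v|u v v'|d u v]; first by rewrite scaler0 tens0l.
- by rewrite scalerDr tensDl.
- by rewrite tensDr.
- by rewrite scalerA mulrC -scalerA tensZ.
Qed.

Fact tensor_scaleE c u v : tensor_scale c (tens u v) = tens (c *: u) v.
Proof. exact: tensor_liftE (balanced_scale c). Qed.

Fact tensor_scale_0 c : tensor_scale c 0 = 0.
Proof. exact: tensor_lift0 (balanced_scale c). Qed.

Fact tensor_scaleDr : right_distributive tensor_scale +%R.
Proof. by move=> c; apply: tensor_liftD (balanced_scale c). Qed.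

Fact tensor_scaleA c d t :
  tensor_scale c (tensor_scale d t) = tensor_scale (c * d) t.
Proof.
elim/tensor_ind: t => [|s t IHs IHt|u v]; first by rewrite !tensor_scale_0.
- by rewrite !tensor_scaleDr IHs IHt.
- by rewrite !tensor_scaleE scalerA.
Qed.

Fact tensor_scale1 : left_id 1 tensor_scale.
Proof.
elim/tensor_ind=> [|s t IHs IHt|u v]; first by rewrite tensor_scale_0.
- by rewrite tensor_scaleDr IHs IHt.
- by rewrite tensor_scaleE scale1r.
Qed.

Fact tensor_scaleDl t : {morph tensor_scale^~ t : c d / c + d}.
Proof.
move=> c d; elim/tensor_ind: t => [|s t IHs IHt|u v].
- by rewrite !tensor_scale_0 addr0.
- by rewrite !tensor_scaleDr IHs IHt addrACA.
- by rewrite !tensor_scaleE scalerDl tensDl.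
Qed.

HB.instance Definition _ := GRing.Zmodule_isLmodule.Build k tensor
  tensor_scaleA tensor_scale1 tensor_scaleDr tensor_scaleDl.

Lemma tensZl c u v : c *: tens u v = tens (c *: u) v.
Proof. exact: tensor_scaleE. Qed.

End TensorDef.

Notation "u *t v" := (tens u v) : ring_scope.

Section TensorMaps.
Variable k : fieldType.

Definition tensor_map (U V U' V' : lmodType k) (f : U -> U') (g : V -> V') :
    tensor U V -> tensor U' V' :=
  tensor_lift (fun u v => f u *t g v).

Definition tensor_assoc (U V W : lmodType k) :
    tensor (tensor U V) W -> tensor U (tensor V W) :=
  tensor_lift (fun t w => tensor_lift (fun u v => u *t (v *t w)) t).

Lemma tensor_mapE (U V U' V' : lmodType k) (f : {linear U -> U'})
    (g : {linear V -> V'}) u v : tensor_map f g (u *t v) = f u *t g v.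
Proof.
apply: tensor_liftE; split=> [{}v|{}u u' {}v|{}u {}v v'|c {}u {}v].
- by rewrite linear0 tens0l.
- by rewrite linearD tensDl.
- by rewrite linearD tensDr.
- by rewrite !linearZ /= tensZ.
Qed.

Lemma tensor_assocE (U V W : lmodType k) (u : U) (v : V) (w : W) :
  tensor_assoc ((u *t v) *t w) = u *t (v *t w).
Proof.
have bal (w' : W) : balanced (fun (u : U) (v : V) => u *t (v *t w')).
  split=> [{}v|{}u u' {}v|{}u {}v v'|c {}u {}v]; first by rewrite tens0l.
  - by rewrite tensDl.
  - by rewrite tensDl tensDr.
  - by rewrite tensZ tensZl.
rewrite /tensor_assoc tensor_liftE; first by rewrite tensor_liftE.
split=> [w'|s t w'|t w1 w2|c t w'].
- exact: tensor_lift0.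
- exact: tensor_liftD.
- elim/tensor_ind: t => [|s t IHs IHt|{}u {}v].
  + by rewrite !tensor_lift0 // addr0.
  + by rewrite !tensor_liftD // IHs IHt addrACA.
  + by rewrite !tensor_liftE // !tensDr.
- elim/tensor_ind: t => [|s t IHs IHt|{}u {}v].
  + by rewrite scaler0 !tensor_lift0.
  + by rewrite scalerDr !tensor_liftD // IHs IHt.
  + by rewrite tensZl !tensor_liftE // !tensZ tensZl tensZ.
Qed.

End TensorMaps.

(* Needed only to show that a tensor product of nonzero algebras is nonzero. *)
Lemma exists_linear_form (k : fieldType) (V : lmodType k) (v : V) : v != 0 ->
  exists f : V -> k,
    [/\ forall c x, f (c *: x) = c * f x, {morph f : x y / x + y} & f v = 1].
Proof.
move=> v0.
pose P (M : set V) := [/\ forall x y, M x -> M y -> M (x + y),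
  forall c x, M x -> M (c *: x) & ~ M v].
have [|M [[MD MZ Mv] maxM]] := @Zorn_bigcup V P.
  move=> F FP Ftot; split.
  - move=> x y [X FX Xx] [Y FY Yy]; have [XY|YX] := Ftot _ _ FX FY.
    + by exists Y => //; have [+ _ _] := FP _ FY; apply => //; exact: XY.
    + by exists X => //; have [+ _ _] := FP _ FX; apply => //; exact: YX.
  - by move=> c x [X FX Xx]; exists X => //; have [_ + _] := FP _ FX; apply.
  - by move=> [X FX Xv]; have [_ _] := FP _ FX; apply.
have M0 : M 0.
  have [[x /(MZ 0)]|nM] := pselect (exists x, M x); first by rewrite scale0r.
  exfalso; apply: (maxM [set 0]).
    split=> [x Mx|/(_ 0 erefl) M0]; first by case: nM; exists x.
    by case: nM; exists 0.
  split=> [x y -> ->|c x ->|/= vE]; first by rewrite /= addr0.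
  - by rewrite /= scaler0.
  - by rewrite vE eqxx in v0.
have MB x y : M x -> M y -> M (x - y).
  by move=> Mx My; apply: MD => //; rewrite -scaleN1r; apply: MZ.
have ex x : exists c, M (x - c *: v).
  have [Mx|nMx] := pselect (M x); first by exists 0; rewrite scale0r subr0.
  pose N := [set y | exists c, M (y - c *: x)].
  have [[c]|nNv] := pselect (N v); last first.
    exfalso; apply: (maxM N).
      split=> [y My|/(_ x) NM]; first by exists 0; rewrite scale0r subr0.
      by apply/nMx/NM; exists 1; rewrite scale1r subrr.
    split=> //.
    - move=> y z [c yc] [d zd]; exists (c + d).
      by rewrite scalerDl opprD addrACA; apply: MD.
    - by move=> c y [d yd]; exists (c * d); rewrite -scalerA -scalerBr; apply: MZ.
  have [->|c0 Mc] := eqVneq c 0; first by rewrite scale0r subr0 => /Mv.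
  exists c^-1; have := MZ (- c^-1) _ Mc.
  by rewrite scalerBr scalerA mulNr mulVf// !scaleNr scale1r opprK addrC.
have uniq x c d : M (x - c *: v) -> M (x - d *: v) -> c = d.
  move=> Mc Md; apply/eqP/negPn/negP => cd; apply: Mv.
  have := MZ (d - c)^-1 _ (MB _ _ Mc Md).
  rewrite opprB [X in _ *: X]addrC addrA subrK -scalerBl scalerA mulVf ?scale1r//.
  by rewrite subr_eq0 eq_sym.
pose f x := sval (cid (ex x)); have fP x : M (x - f x *: v) := svalP (cid (ex x)).
exists f; split=> [c x|x y|].
- by apply: uniq (fP _) _; rewrite -scalerA -scalerBr; apply: MZ.
- by apply: uniq (fP _) _; rewrite scalerDl opprD addrACA; apply: MD.
- by apply: uniq (fP _) _; rewrite scale1r subrr.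
Qed.

Section TensorAlgebra.
Variables (k : fieldType) (A B : comAlgType k).
Implicit Types s t r : tensor A B.

Definition tensor_mulr_pure (a : A) (b : B) : tensor A B -> tensor A B :=
  tensor_lift (fun a' b' => (a * a') *t (b * b')).

Definition tensor_mul (s t : tensor A B) : tensor A B :=
  tensor_lift (fun a b => tensor_mulr_pure a b t) s.

Definition tensor_one : tensor A B := 1 *t 1.

Fact balanced_mulr_pure a b :
  balanced (fun (a' : A) (b' : B) => (a * a') *t (b * b')).
Proof.
split=> [b'|a' a'' b'|a' b' b''|c a' b']; first by rewrite mulr0 tens0l.
- by rewrite mulrDr tensDl.
- by rewrite mulrDr tensDr.
- by rewrite -!scalerAr tensZ.
Qed.

Fact tensor_mulr_pureD a b : {morph tensor_mulr_pure a b : s t / s + t}.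
Proof. exact/tensor_liftD/balanced_mulr_pure. Qed.

Fact tensor_mulr_pure0 a b : tensor_mulr_pure a b 0 = 0.
Proof. exact/tensor_lift0/balanced_mulr_pure. Qed.

Fact tensor_mulr_pureE a b a' b' :
  tensor_mulr_pure a b (a' *t b') = (a * a') *t (b * b').
Proof. exact/tensor_liftE/balanced_mulr_pure. Qed.

Fact balanced_mul t : balanced (fun a b => tensor_mulr_pure a b t).
Proof.
split=> [b|a a' b|a b b'|c a b]; elim/tensor_ind: t => [|s t IHs IHt|x y];
  rewrite ?tensor_mulr_pure0 ?addr0 //;
  rewrite ?tensor_mulr_pureD ?IHs ?IHt ?addr0 // 1?addrACA //
          !tensor_mulr_pureE.
- by rewrite mul0r tens0l.
- by rewrite mulrDl tensDl.
- by rewrite mulrDl tensDr.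
- by rewrite -!scalerAl tensZ.
Qed.

Fact tensor_mulE (a a' : A) (b b' : B) :
  tensor_mul (a *t b) (a' *t b') = (a * a') *t (b * b').
Proof.
by rewrite /tensor_mul (tensor_liftE _ _ (balanced_mul _)) tensor_mulr_pureE.
Qed.

Fact tensor_mulDl : left_distributive tensor_mul +%R.
Proof. by move=> s t r; apply/tensor_liftD/balanced_mul. Qed.

Fact tensor_mul0l : left_zero 0 tensor_mul.
Proof. by move=> t; apply/tensor_lift0/balanced_mul. Qed.

Fact tensor_mulC : commutative tensor_mul.
Proof.
have mul0r s : tensor_mul s 0 = 0.
  elim/tensor_ind: s => [|s t IHs IHt|a b]; first exact: tensor_mul0l.
  - by rewrite tensor_mulDl IHs IHt addr0.
  - by rewrite /tensor_mul (tensor_liftE _ _ (balanced_mul _))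
               tensor_mulr_pure0.
have mulDr r s t : tensor_mul r (s + t) = tensor_mul r s + tensor_mul r t.
  elim/tensor_ind: r => [|r r' IHr IHr'|a b].
  - by rewrite !tensor_mul0l addr0.
  - by rewrite !tensor_mulDl IHr IHr' addrACA.
  - by rewrite /tensor_mul !(tensor_liftE _ _ (balanced_mul _))
               tensor_mulr_pureD.
move=> s t; elim/tensor_ind: s => [|s s' IHs IHs'|a b].
- by rewrite tensor_mul0l mul0r.
- by rewrite tensor_mulDl mulDr IHs IHs'.
elim/tensor_ind: t => [|t t' IHt IHt'|a' b'].
- by rewrite tensor_mul0l mul0r.
- by rewrite tensor_mulDl mulDr IHt IHt'.
- by rewrite !tensor_mulE mulrC [b * b']mulrC.
Qed.

Fact tensor_mulA : associative tensor_mul.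
Proof.
move=> s t r; elim/tensor_ind: s => [|s s' IHs IHs'|a b].
- by rewrite !tensor_mul0l.
- by rewrite !tensor_mulDl IHs IHs'.
elim/tensor_ind: t => [|t t' IHt IHt'|a' b'].
- by rewrite [tensor_mul _ 0]tensor_mulC !tensor_mul0l [LHS]tensor_mulC
             tensor_mul0l.
- rewrite tensor_mulDl [LHS]tensor_mulC tensor_mulDl.
  rewrite [X in X + _]tensor_mulC IHt [X in _ + X]tensor_mulC IHt'.
  rewrite -tensor_mulDl; congr tensor_mul.
  by rewrite ![tensor_mul (a *t b) _]tensor_mulC tensor_mulDl.
elim/tensor_ind: r => [|r r' IHr IHr'|a'' b''].
- rewrite ![tensor_mul _ 0]tensor_mulC !tensor_mul0l.
  by rewrite [LHS]tensor_mulC tensor_mul0l.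
- rewrite ![tensor_mul _ (r + r')]tensor_mulC !tensor_mulDl [LHS]tensor_mulC.
  rewrite tensor_mulDl ![tensor_mul _ (a *t b)]tensor_mulC.
  by rewrite [tensor_mul r _]tensor_mulC IHr [tensor_mul r' _]tensor_mulC IHr'
             ![tensor_mul _ (tensor_mul _ _)]tensor_mulC.
- by rewrite !tensor_mulE !mulrA.
Qed.

Fact tensor_mul1 : left_id tensor_one tensor_mul.
Proof.
move=> t; rewrite tensor_mulC.
elim/tensor_ind: t => [|s t IHs IHt|a b]; first by rewrite tensor_mul0l.
- by rewrite tensor_mulDl IHs IHt.
- by rewrite /tensor_one tensor_mulE !mulr1.
Qed.

Fact tensor_one_neq0 : tensor_one != 0.
Proof.
have [f [fZ fD f1]] := exists_linear_form (oner_neq0 A).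
have bf : balanced (fun (a : A) (b : B) => f a *: b).
  split=> [b|a a' b|a b b'|c a b]; last by rewrite fZ scalerA mulrC.
  - by rewrite -(scale0r 0) fZ mul0r scale0r.
  - by rewrite fD scalerDl.
  - by rewrite scalerDr.
apply/eqP => /(congr1 (tensor_lift (fun (a : A) (b : B) => f a *: b))).
rewrite /tensor_one tensor_liftE// tensor_lift0// f1 scale1r.
by apply/eqP/oner_neq0.
Qed.

HB.instance Definition _ := GRing.Zmodule_isComNzRing.Build (tensor A B)
  tensor_mulA tensor_mulC tensor_mul1 tensor_mulDl tensor_one_neq0.

Lemma tensM (a a' : A) (b b' : B) :
  (a *t b) * (a' *t b') = (a * a') *t (b * b').
Proof. exact: tensor_mulE. Qed.

Fact tensor_scaleAl (c : k) s t : c *: (s * t) = (c *: s) * t.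
Proof.
elim/tensor_ind: s => [|s s' IHs IHs'|a b].
- by rewrite scaler0 !mul0r scaler0.
- by rewrite scalerDr !mulrDl scalerDr IHs IHs'.
elim/tensor_ind: t => [|t t' IHt IHt'|a' b'].
- by rewrite !mulr0 scaler0.
- by rewrite !mulrDr scalerDr IHt IHt'.
- by rewrite tensM !tensZl tensM scalerAl.
Qed.

HB.instance Definition _ :=
  GRing.Lmodule_isLalgebra.Build k (tensor A B) tensor_scaleAl.

HB.instance Definition _ := GRing.Lalgebra_isComAlgebra.Build k (tensor A B).

End TensorAlgebra.

HB.mixin Record isSigmaRing (n : nat) R of GRing.ComNzRing R := {
  sigma : 'I_n -> {rmorphism R -> R};
  sigmaC : forall i j x, sigma i (sigma j x) = sigma j (sigma i x)
}.

#[short(type="sigmaRingType")]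
HB.structure Definition SigmaRing (n : nat) :=
  {R of GRing.ComNzRing R & isSigmaRing n R}.

#[short(type="sigmaFieldType")]
HB.structure Definition SigmaField (n : nat) :=
  {K of GRing.Field K & isSigmaRing n K}.

(* The structural morphism k -> A is c |-> c%:A. *)
HB.mixin Record SigmaRing_isSigmaAlgebra (n : nat) (k : sigmaFieldType n) A
    of SigmaRing n A & GRing.ComAlgebra k A := {
  sigma_alg : forall (j : 'I_n) (c : k),
    sigma j (c%:A : A) = (sigma j c)%:A
}.

#[short(type="sigmaAlgType")]
HB.structure Definition SigmaAlgebra (n : nat) (k : sigmaFieldType n) :=
  {A of SigmaRing n A & GRing.ComAlgebra k A &
        SigmaRing_isSigmaAlgebra n k A}.

Definition sigma_morphism (n : nat) (R S : sigmaRingType n) (f : R -> S) :=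
  forall (j : 'I_n) (x : R), f (sigma j x) = sigma j (f x).

Section SigmaTensor.
Variables (n : nat) (k : sigmaFieldType n) (A B : sigmaAlgType k).
Implicit Types (j : 'I_n) (s t : tensor A B).

Definition tensor_sigma j : tensor A B -> tensor A B :=
  tensor_map (sigma j : A -> A) (sigma j : B -> B).

Lemma sigmaZ (C : sigmaAlgType k) j (c : k) (x : C) :
  sigma j (c *: x) = sigma j c *: sigma j x.
Proof. by rewrite -mulr_algl rmorphM /= sigma_alg mulr_algl. Qed.

Fact balanced_sigma j :
  balanced (fun (a : A) (b : B) => sigma j a *t sigma j b).
Proof.
split=> [b|a a' b|a b b'|c a b].
- by rewrite rmorph0 tens0l.
- by rewrite rmorphD tensDl.
- by rewrite rmorphD tensDr.
- by rewrite !sigmaZ tensZ.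
Qed.

Fact tensor_sigmaE j a b : tensor_sigma j (a *t b) = sigma j a *t sigma j b.
Proof. exact/tensor_liftE/balanced_sigma. Qed.

Fact tensor_sigma0 j : tensor_sigma j 0 = 0.
Proof. exact/tensor_lift0/balanced_sigma. Qed.

Fact tensor_sigmaD j : {morph tensor_sigma j : s t / s + t}.
Proof. exact/tensor_liftD/balanced_sigma. Qed.

Fact tensor_sigma_nmod j : nmod_morphism (tensor_sigma j).
Proof. by split; [exact: tensor_sigma0|exact: tensor_sigmaD]. Qed.

Fact tensor_sigma_monoid j : monoid_morphism (tensor_sigma j).
Proof.
split=> [|s t]; first by rewrite [LHS]tensor_sigmaE !rmorph1.
elim/tensor_ind: s => [|s s' IHs IHs'|a b].
- by rewrite !(mul0r, tensor_sigma0).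
- by rewrite mulrDl !tensor_sigmaD mulrDl IHs IHs'.
elim/tensor_ind: t => [|t t' IHt IHt'|a' b'].
- by rewrite !(mulr0, tensor_sigma0).
- by rewrite mulrDr !tensor_sigmaD mulrDr IHt IHt'.
- by rewrite tensM !tensor_sigmaE tensM !rmorphM.
Qed.

HB.instance Definition _ j :=
  GRing.isNmodMorphism.Build (tensor A B) (tensor A B) (tensor_sigma j)
    (tensor_sigma_nmod j).
HB.instance Definition _ j :=
  GRing.isMonoidMorphism.Build (tensor A B) (tensor A B) (tensor_sigma j)
    (tensor_sigma_monoid j).

Fact tensor_sigmaC i j t :
  tensor_sigma i (tensor_sigma j t) = tensor_sigma j (tensor_sigma i t).
Proof.
elim/tensor_ind: t => [|s t IHs IHt|a b]; first by rewrite !tensor_sigma0.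
- by rewrite !tensor_sigmaD IHs IHt.
- by rewrite !tensor_sigmaE sigmaC [sigma i (sigma j b)]sigmaC.
Qed.

HB.instance Definition _ := isSigmaRing.Build n (tensor A B)
  (sigma := fun j => tensor_sigma j : {rmorphism _ -> _}) tensor_sigmaC.

Lemma sigma_tens (j : 'I_n) (a : A) (b : B) :
  sigma j (a *t b) = sigma j a *t sigma j b.
Proof. exact: tensor_sigmaE. Qed.

Fact tensor_sigma_alg j (c : k) :
  sigma j (c%:A : tensor A B) = (sigma j c)%:A.
Proof.
rewrite [LHS](_ : _ = sigma j ((c *: 1 : A) *t (1 : B))); last first.
  by congr (sigma j _); exact: tensZl.
by rewrite sigma_tens sigma_alg rmorph1 -tensZl.
Qed.

HB.instance Definition _ :=
  SigmaRing_isSigmaAlgebra.Build n k (tensor A B) tensor_sigma_alg.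

End SigmaTensor.

(* In a commutative Hopf algebra the antipode is automatically multiplicative;
   being an algebra morphism is part of the structure here. *)
HB.mixin Record ComAlgebra_isHopf (k : fieldType) A of GRing.ComAlgebra k A := {
  comul : {lrmorphism A -> tensor A A};
  counit : {lrmorphism A -> k | *%R};
  antipode : {lrmorphism A -> A};
  comulA : forall a : A,
    tensor_assoc (tensor_map comul idfun (comul a)) =
    tensor_map idfun comul (comul a);
  counitl : forall a : A, tensor_lift (fun x y => counit x *: y) (comul a) = a;
  counitr : forall a : A, tensor_lift (fun x y => counit y *: x) (comul a) = a;
  antipodel : forall a : A,
    tensor_lift (fun x y => antipode x * y) (comul a) = (counit a)%:A;
  antipoder : forall a : A,
    tensor_lift (fun x y => x * antipode y) (comul a) = (counit a)%:A
}.

#[short(type="hopfAlgType")]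
HB.structure Definition HopfAlgebra (k : fieldType) :=
  {A of GRing.ComAlgebra k A & ComAlgebra_isHopf k A}.

HB.mixin Record SigmaAlgebra_isSigmaHopf (n : nat) (k : sigmaFieldType n) A
    of SigmaAlgebra n k A & HopfAlgebra k A := {
  comul_sigma : sigma_morphism (comul : A -> tensor A A);
  counit_sigma : sigma_morphism (counit : A -> k);
  antipode_sigma : sigma_morphism (antipode : A -> A)
}.

#[short(type="sigmaHopfType")]
HB.structure Definition SigmaHopf (n : nat) (k : sigmaFieldType n) :=
  {A of SigmaAlgebra n k A & HopfAlgebra k A & SigmaAlgebra_isSigmaHopf n k A}.

(* The action of the monomial sigma_1^(e 1) ... sigma_n^(e n). *)
Definition sigma_mon (n : nat) (R : sigmaRingType n) (e : 'I_n -> nat) : R -> R :=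
  \big[comp/idfun]_(j < n) iter (e j) (sigma j).

Definition generated_subalg (k : fieldType) (A : comAlgType k) (G : set A) :
    set A :=
  smallest [set C | GRing.subalg_closed [in C]] G.

(* B = k[tau(f) | tau a monomial, f in F] for some finite F included in B, where
   B is a sigma-stable subalgebra of R; B = [set: R] gives the notion for R. *)
Definition finitely_sigma_generated (n : nat) (k : sigmaFieldType n)
    (R : sigmaAlgType k) (B : set R) : Prop :=
  exists F : set R, [/\ finite_set F, F `<=` B &
    B = generated_subalg [set sigma_mon e f | e in [set: 'I_n -> nat] & f in F]].

(* The image of B (x) B in A (x) A; over a field B (x) B -> A (x) A is
   injective, so this is B (x) B itself. *)
Definition sub_tensor (k : fieldType) (A : comAlgType k) (B : set A) :
    set (tensor A A) :=
  [set t | exists s : seq (A * A),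
     (forall p, p \in s -> B p.1 /\ B p.2) /\ t = \sum_(p <- s) p.1 *t p.2].

Definition hopf_subalgebra (k : fieldType) (A : hopfAlgType k) (B : set A) :
    Prop :=
  [/\ GRing.subalg_closed [in B],
      forall b, B b -> sub_tensor B (comul b) &
      forall b, B b -> B (antipode b)].

Definition sigma_hopf_subalgebra (n : nat) (k : sigmaFieldType n)
    (A : sigmaHopfType k) (B : set A) : Prop :=
  hopf_subalgebra B /\ forall (j : 'I_n) b, B b -> B (sigma j b).

(* Main.v *)
Require Import Defs.
From HB Require Import structures.
From mathcomp Require Import all_boot all_order all_algebra all_classical.
From mathcomp Require Import mpoly.
Set Implicit Arguments.
Unset Strict Implicit.
Unset Printing Implicit Defensive.
Import Order.TTheory GRing.Theory.
Local Open Scope classical_set_scope.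
Local Open Scope ring_scope.

(** Think of [A] as the coordinate ring of an affine group [H] on which the
    endomorphisms act, and of [B] as that of a quotient group. Over a field the
    quotient is determined by its kernel: Hopf subalgebras [C <= B] with
    [C^+ A = B^+ A] are equal ([hopf_subalgebra_descent]). It therefore suffices
    to find a finitely generated difference Hopf subalgebra [C] of [B] with
    [C^+ A = B^+ A]. As every finite subset of [B] lies in the span of a finite
    set stable under coproduct and antipode ([finite_hopf_hull]), the witnesses
    of any finite amount of information on the ideal [I = B^+ A] can be put in
    such a [C].

    The finite information is a set of leading monomials. Let [A] be generated by
    the translates [tau g] with [g] in a finite Hopf-stable set [G], and order the
    [tau] by a monomial order. The subalgebras generated by the [tau' g] with
    [tau' < tau], respectively [tau' <= tau], are Hopf subalgebras
    [D_tau <= E_tau], and [E_tau] modulo [D_tau^+] is generated by the finitely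
    many [tau g]. So the elements of [I] that lie in [E_tau] modulo
    [D_tau^+ A] have leading monomials [al] in the [tau g]. The pairs [(tau, al)] form an upward closed set, because [I] is
    stable under the endomorphisms ([lead_up]), and Dickson's lemma provides
    finitely many minimal ones ([finite_basis]). Choose [C] such that
    [J = C^+ A] has them all. Polynomial division shows that [I] and [J] agree
    on [E_tau] modulo [D_tau^+ A] ([division]), and by induction on [tau] they
    agree on [D_tau]: two nested closed subgroups with the same kernel
    and the same image under a quotient map are equal
    ([hopf_ideal_descent]), so [I] and [J] agree on [E_tau], hence everywhere.

    Both descent statements rest on one property of a Hopf subalgebra [D] and a
    Hopf ideal [I], namely that [D/(D & I) -> A/I] is a pure map of
    [D]-modules: any finite part of [A/I] admits a [D]-linear retraction to
    [D/(D & I)] ([exists_local_retraction]). To see this, take a finite right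
    coideal spanned by elements [v q], one of them [v o = 1], and consider the
    linear forms [u] over [D] that kill all relations among the [v q] modulo [I].
    The values [u o] form an ideal [T] of [D]. It is nonzero modulo [I], by
    Cramer's rule with a nonzero minor of maximal size ([maximal_minor]), and it
    is stable under the coaction ([coform_costable]). A nonzero costable ideal of
    a Hopf algebra contains [1], so there is a form with [u o = 1], which is the
    retraction ([unit_coform]). Descent follows with the Galois map
    [a (x) b |-> a S(b_1) (x) b_2], which sends the coproduct of [x] to
    [1 (x) x]. *)

(** * Linear algebra over a field *)

Section LinearAlgebra.
Variable k : fieldType.

Definition subspace (V : lmodType k) (M : set V) : Prop :=
  M 0 /\ forall c x y, M x -> M y -> M (c *: x + y).

Section Subspace.
Variables (V : lmodType k) (M : set V).
Hypothesis subM : subspace M.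

Lemma subspace0 : M 0. Proof. by case: subM. Qed.

Lemma subspaceD x y : M x -> M y -> M (x + y).
Proof. by move=> Mx My; rewrite -[x]scale1r; apply: subM.2. Qed.

Lemma subspaceZ c x : M x -> M (c *: x).
Proof. by move=> Mx; rewrite -[_ *: _]addr0; apply: subM.2 => //; apply: subspace0. Qed.

Lemma subspaceN x : M x -> M (- x).
Proof. by rewrite -scaleN1r; apply: subspaceZ. Qed.

Lemma subspaceB x y : M x -> M y -> M (x - y).
Proof. by move=> Mx My; apply: subspaceD => //; apply: subspaceN. Qed.

Lemma subspace_sum (J : Type) (r : seq J) (P : pred J) (F : J -> V) :
  (forall i, P i -> M (F i)) -> M (\sum_(i <- r | P i) F i).
Proof. by move=> MF; apply: big_ind => //; [apply: subspace0|apply: subspaceD]. Qed.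

Lemma subspace_sum_seq (J : eqType) (r : seq J) (F : J -> V) :
  (forall i, i \in r -> M (F i)) -> M (\sum_(i <- r) F i).
Proof. by move=> MF; rewrite big_seq; apply: subspace_sum. Qed.

End Subspace.

Lemma exists_linear (U V : lmodType k) (f : U -> V) :
  linear f -> exists g : {linear U -> V}, g =1 f.
Proof.
move=> lf.
pose g : {linear U -> V} := HB.pack f (GRing.isLinear.Build k U V *:%R f lf).
by exists g.
Qed.

Lemma exists_scalar (U : lmodType k) (f : U -> k) :
  scalar f -> exists g : {scalar U}, g =1 f.
Proof.
move=> lf.
pose g : {scalar U} := HB.pack f (GRing.isLinear.Build k U k *%R f lf).
by exists g.
Qed.

Lemma exists_projection (V : lmodType k) (M : set V) : subspace M ->
  exists p : {linear V -> V}, (forall x, M x -> p x = 0) /\ forall x, M (p x - x).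
Proof.
move=> subM.
(* A subspace [N] maximal among those meeting [M] trivially is a complement. *)
pose P (N : set V) := [/\ forall x y, N x -> N y -> N (x + y),
  forall c x, N x -> N (c *: x) & forall x, N x -> M x -> x = 0].
have [|N [[ND NZ NM] maxN]] := @Zorn_bigcup V P.
  move=> F FP Ftot; split.
  - move=> x y [X FX Xx] [Y FY Yy]; have [XY|YX] := Ftot _ _ FX FY.
    + by exists Y => //; have [+ _ _] := FP _ FY; apply => //; exact: XY.
    + by exists X => //; have [+ _ _] := FP _ FX; apply => //; exact: YX.
  - by move=> c x [X FX Xx]; exists X => //; have [_ + _] := FP _ FX; apply.
  - by move=> x [X FX Xx]; have [_ _] := FP _ FX; apply.
have N0 : N 0.
  have [[x /(NZ 0)]|nN] := pselect (exists x, N x); first by rewrite scale0r.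
  exfalso; apply: (maxN [set 0]).
    split=> [x Nx|/(_ 0 erefl) N0]; first by case: nN; exists x.
    by case: nN; exists 0.
  split=> [x y -> ->|c x ->|x -> //]; first by rewrite /= addr0.
  by rewrite /= scaler0.
have subN : subspace N by split=> // c x y Nx Ny; apply: ND => //; apply: NZ.
have ex x : exists y, N y /\ M (y - x).
  have [//|nx] := pselect (exists y, N y /\ M (y - x)).
  pose N' := [set y | exists2 c, N (y - c *: x) & True].
  exfalso; apply: (maxN N').
    split=> [y Ny|]; first by exists 0 => //; rewrite scale0r subr0.
    move=> /(_ x) N'x; have Nx : N x; first apply: N'x.
      by exists 1 => //; rewrite scale1r subrr.
    by apply: nx; exists x; rewrite subrr; split => //; apply: subspace0.
  split.
  - move=> y z [c yc _] [d zd _]; exists (c + d) => //.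
    by rewrite scalerDl opprD addrACA; apply: ND.
  - move=> c y [d yd _]; exists (c * d) => //.
    by rewrite -scalerA -scalerBr; apply: NZ.
  - move=> y [c]; have [->|c0] := eqVneq c 0.
      by rewrite scale0r subr0 => Ny _; apply: NM.
    move=> Nc _ My; case: nx; exists (- c^-1 *: (y - c *: x)); split.
      exact: NZ.
    rewrite scalerBr !scaleNr scalerA mulVf// scale1r opprK addrK.
    exact/(subspaceN subM)/(subspaceZ subM).
have uniq x y y' : N y -> M (y - x) -> N y' -> M (y' - x) -> y = y'.
  move=> Ny My Ny' My'; apply/eqP; rewrite -subr_eq0; apply/eqP/NM.
    exact: (subspaceB subN).
  by have := subspaceB subM My My'; rewrite opprB addrA subrK.
pose f x := sval (cid (ex x)).
have [fN fM] : (forall x, N (f x)) /\ forall x, M (f x - x).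
  by split=> x; case: (svalP (cid (ex x))).
have [|p pE] := @exists_linear V V f.
  move=> c x y; apply: uniq (fN _) (fM _) (subN.2 _ _ _ (fN _) (fN _)) _.
  by rewrite opprD addrACA -scalerBr; apply: subM.2.
exists p; split=> x; rewrite pE // => Mx.
by apply: uniq (fN x) (fM x) N0 _; rewrite sub0r; apply: subspaceN.
Qed.

Lemma exists_functional (V : lmodType k) (Y : set V) (v : V) :
  subspace Y -> ~ Y v ->
  exists mu : {scalar V}, (forall y, Y y -> mu y = 0) /\ mu v = 1.
Proof.
move=> subY nYv; have [p [pY pV]] := exists_projection subY.
have pv0 : p v != 0.
  apply/eqP => pv0; apply: nYv; have := subspaceN subY (pV v).
  by rewrite pv0 sub0r opprK.
have [f [fZ fD fpv]] := exists_linear_form pv0.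
have [|mu muE] := @exists_scalar V (f \o p).
  by move=> c x y /=; rewrite linearP fD fZ.
exists mu; split=> [y Yy|]; rewrite muE //= pY //.
by rewrite -(scale0r 0) fZ mul0r.
Qed.

(** A correspondence that is single-valued only up to a subspace can thus be
    replaced by a linear map, defined everywhere; its values are still related
    to something, which keeps control of its range. *)
Lemma linear_selection (V W : lmodType k) (G : set (V * W)) : subspace G ->
  exists f : {linear V -> W},
    (forall x y, G (x, y) -> G (x, f x)) /\ forall x, exists x', G (x', f x).
Proof.
move=> subG; pose K := [set y | G (0, y)]; pose D := [set x | exists y, G (x, y)].
have GP c x y x' y' : G (x, y) -> G (x', y') -> G (c *: x + x', c *: y + y').
  exact: (subG.2 c (x, y) (x', y')).
have subK : subspace K.
  split=> [|c x y Kx Ky]; first exact: subspace0 subG.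
  by have := GP c _ _ _ _ Kx Ky; rewrite scaler0 addr0.
have subD : subspace D.
  split=> [|c x x' [y xy] [y' xy']]; first by exists 0; exact: subspace0 subG.
  by exists (c *: y + y'); apply: GP.
(* [q] removes the indeterminacy [K] of [G]; [x - p x] lies in the domain [D]. *)
have [q [qK qW]] := exists_projection subK.
have [p [pD pV]] := exists_projection subD.
have qG x y y' : G (x, y) -> G (x, y') -> q y = q y'.
  move=> xy xy'; apply/eqP; rewrite -subr_eq0 -linearB; apply/eqP/qK.
  have := GP (-1) _ _ _ _ xy' xy.
  by rewrite !scaleN1r addNr addrC.
have ex x : exists y, G (x - p x, y).
  by have [y xy] := subspaceN subD (pV x); exists y; rewrite -opprB.
pose g x := sval (cid (ex x)); have gP x : G (x - p x, g x) := svalP (cid (ex x)).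
have [|f fE] := @exists_linear V W (q \o g).
  move=> c x y /=; rewrite -linearP; apply: qG (gP _) _.
  by rewrite linearP opprD addrACA -scalerBr; apply: GP.
have fG x : G (x - p x, f x).
  have := GP 1 _ _ _ _ (qW (g x)) (gP x).
  by rewrite fE scaler0 add0r scale1r subrK.
exists f; split=> [x y xy|x]; last by exists (x - p x).
have Dx : D x by exists y.
by have := fG x; rewrite pD // subr0.
Qed.

End LinearAlgebra.

(** * Maps out of a tensor product *)

Section TensorProductMaps.
Variable k : fieldType.

Section Tprod.
Variables (U V : lmodType k) (T : comAlgType k).

(** Contraction with a functional, the two sides of the antipode axiom, the
    reconstruction of [comul] and the Galois map below all have this form, with
    different [f], [g] and target algebras. *)
Definition tprod (f : U -> T) (g : V -> T) : tensor U V -> T :=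
  tensor_lift (fun u v => f u * g v).

Variables (f : {linear U -> T}) (g : {linear V -> T}).

Fact balanced_tprod : balanced (fun u v => f u * g v).
Proof.
split=> [v|u u' v|u v v'|c u v]; first by rewrite linear0 mul0r.
- by rewrite linearD mulrDl.
- by rewrite linearD mulrDr.
- by rewrite !linearZ /= -scalerAl -scalerAr.
Qed.

Lemma tprodE u v : tprod f g (u *t v) = f u * g v.
Proof. exact: tensor_liftE balanced_tprod. Qed.

Fact tprod_linear : linear (tprod f g).
Proof.
move=> c s t; rewrite /tprod (tensor_liftD balanced_tprod) -/(tprod f g); congr (_ + _).
elim/tensor_ind: s => [|s s' IHs IHs'|u v].
- by rewrite scaler0 /tprod (tensor_lift0 balanced_tprod) scaler0.
- by rewrite scalerDr /tprod !(tensor_liftD balanced_tprod) -!/(tprod f g) IHs IHs' scalerDr.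
- by rewrite tensZl !tprodE linearZ scalerAl.
Qed.

HB.instance Definition _ :=
  GRing.isLinear.Build k (tensor U V) T *:%R (tprod f g) tprod_linear.

End Tprod.

Definition inl_tens (A B : comAlgType k) (a : A) : tensor A B := a *t 1.
Definition inr_tens (A B : comAlgType k) (b : B) : tensor A B := 1 *t b.

Section Inclusions.
Variables A B : comAlgType k.

Fact inl_tens_linear : linear (@inl_tens A B).
Proof. by move=> c x y; rewrite /inl_tens tensDl tensZl. Qed.

Fact inl_tens_monoid : monoid_morphism (@inl_tens A B).
Proof. by split=> // x y; rewrite /inl_tens tensM mulr1. Qed.

HB.instance Definition _ :=
  GRing.isLinear.Build k A (tensor A B) *:%R (@inl_tens A B) inl_tens_linear.
HB.instance Definition _ :=
  GRing.isMonoidMorphism.Build A (tensor A B) (@inl_tens A B) inl_tens_monoid.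

Fact inr_tens_linear : linear (@inr_tens A B).
Proof. by move=> c x y; rewrite /inr_tens tensDr tensZl tensZ. Qed.

Fact inr_tens_monoid : monoid_morphism (@inr_tens A B).
Proof. by split=> // x y; rewrite /inr_tens tensM mulr1. Qed.

HB.instance Definition _ :=
  GRing.isLinear.Build k B (tensor A B) *:%R (@inr_tens A B) inr_tens_linear.
HB.instance Definition _ :=
  GRing.isMonoidMorphism.Build B (tensor A B) (@inr_tens A B) inr_tens_monoid.

Lemma tens_mul (a : A) (b : B) : a *t b = inl_tens B a * inr_tens A b.
Proof. by rewrite tensM mulr1 mul1r. Qed.

End Inclusions.

Section Scalars.
Variables (U : lmodType k) (T : comAlgType k).

Definition cst (mu : U -> k) (u : U) : T := (mu u)%:A.

Fact cst_linear (mu : {scalar U}) : linear (cst mu).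
Proof. by move=> c x y; rewrite /cst linearP scalerDl scalerA. Qed.

HB.instance Definition _ (mu : {scalar U}) :=
  GRing.isLinear.Build k U T *:%R (cst mu) (cst_linear mu).

End Scalars.

End TensorProductMaps.

Arguments inl_tens {k A B} a.
Arguments inr_tens {k A B} b.
Arguments cst {k U} T mu u.

(** * Convolution *)

Section Convolution.
Variables (k : fieldType) (A : hopfAlgType k).

Section Conv.
Variable T : comAlgType k.

Definition conv (f g : A -> T) (a : A) : T := tprod f g (comul a).

Fact conv_linear (f g : {linear A -> T}) : linear (conv f g).
Proof. by move=> c x y; rewrite /conv !linearP. Qed.

HB.instance Definition _ (f g : {linear A -> T}) :=
  GRing.isLinear.Build k A T *:%R (conv f g) (conv_linear f g).

(** Coassociativity. As every iterated coproduct below is a convolution, this is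
    the only place where triple tensor products occur. *)
Lemma convA (f g h : {linear A -> T}) : conv (conv f g) h =1 conv f (conv g h).
Proof.
move=> a; rewrite /conv.
pose F : {linear tensor (tensor A A) A -> T} := tprod (tprod f g) h.
pose G : {linear tensor A (tensor A A) -> T} := tprod f (tprod g h).
have FG s : G (tensor_assoc s) = F s.
  rewrite {2}(tensor_repr_sum s) linear_sum [RHS]linear_sum /=.
  apply: eq_bigr => p _; rewrite [LHS]linear_sum [RHS]tprodE.
  rewrite -[RHS]/((\sum_(q <- repr p.1) f q.1 * g q.2) * h p.2) mulr_suml.
  by apply: eq_bigr => q _; rewrite [LHS]tprodE /= tprodE mulrA.
transitivity (F (tensor_map comul idfun (comul a))).
  rewrite /F /tensor_map /tensor_lift linear_sum; apply: eq_bigr => p _ /=.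
  by rewrite tprodE.
rewrite -FG comulA /G /tensor_map /tensor_lift linear_sum; apply: eq_bigr => p _ /=.
by rewrite tprodE.
Qed.

Lemma eq_conv (f f' g g' : A -> T) : f =1 f' -> g =1 g' -> conv f g =1 conv f' g'.
Proof. by move=> /funext -> /funext ->. Qed.

Lemma conv_cstl (f : {linear A -> T}) : conv (cst T counit) f =1 f.
Proof.
move=> a; rewrite -[in RHS](counitl a) /conv /tprod /tensor_lift linear_sum.
by apply: eq_bigr => p _; rewrite /cst linearZ mulr_algl.
Qed.

Lemma conv_cstr (f : {linear A -> T}) : conv f (cst T counit) =1 f.
Proof.
move=> a; rewrite -[in RHS](counitr a) /conv /tprod /tensor_lift linear_sum.
by apply: eq_bigr => p _; rewrite /cst linearZ mulr_algr.
Qed.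

End Conv.

Section ConvMorphism.
Variable T : comAlgType k.

Lemma conv_comp (T' : comAlgType k) (F : {lrmorphism T' -> T}) (f g : {linear A -> T'}) :
  conv (F \o f) (F \o g) =1 F \o conv f g.
Proof.
move=> a; rewrite /conv /tprod /tensor_lift /= linear_sum.
by apply: eq_bigr => p _; rewrite rmorphM.
Qed.

Lemma conv_antipodel (F : {lrmorphism A -> T}) :
  conv (F \o antipode) F =1 cst T counit.
Proof.
move=> a; rewrite (conv_comp F antipode idfun) /conv /tprod /= antipodel.
by rewrite linearZ rmorph1.
Qed.

Lemma conv_antipoder (F : {lrmorphism A -> T}) :
  conv F (F \o antipode) =1 cst T counit.
Proof.
move=> a; rewrite (conv_comp F idfun antipode) /conv /tprod /= antipoder.
by rewrite linearZ rmorph1.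
Qed.

End ConvMorphism.

Lemma comul_conv : (comul : A -> tensor A A) =1 conv inl_tens inr_tens.
Proof.
move=> a; rewrite /conv [LHS](tensor_repr_sum (comul a)).
by apply: eq_bigr => p _; rewrite tens_mul.
Qed.

End Convolution.

(** * Subspaces of a tensor square *)

Section TensorSpan.
Variables (k : fieldType) (A : comAlgType k).
Implicit Types (P Q : A -> A -> Prop) (t : tensor A A) (mu : {scalar A}).

(** A predicate on pairs covers at once [B (x) B], which is [sub_tensor B], the
    sums [I (x) A + A (x) I], and products [D (x) A]. *)
Definition tspan P : set (tensor A A) :=
  [set t | exists s : seq (A * A),
     (forall p, p \in s -> P p.1 p.2) /\ t = \sum_(p <- s) p.1 *t p.2].

Lemma tspan0 P : tspan P 0.
Proof. by exists [::]; rewrite big_nil. Qed.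

Lemma tspanD P t t' : tspan P t -> tspan P t' -> tspan P (t + t').
Proof.
move=> [s [sP ->]] [s' [sP' ->]]; exists (s ++ s'); rewrite big_cat; split=> //.
by move=> p; rewrite mem_cat => /orP[/sP|/sP'].
Qed.

Lemma tspan_tens P a b : P a b -> tspan P (a *t b).
Proof.
move=> Pab; exists [:: (a, b)]; rewrite big_seq1; split=> // p.
by rewrite inE => /eqP ->.
Qed.

Lemma tspan_le P Q t : (forall a b, P a b -> Q a b) -> tspan P t -> tspan Q t.
Proof. by move=> PQ [s [sP ->]]; exists s; split=> // p /sP /PQ. Qed.

Lemma tspan_subspace P :
  (forall c a b, P a b -> P (c *: a) b) -> subspace (tspan P).
Proof.
move=> PZ; split=> [|c x y [s [sP ->]] Py]; first exact: tspan0.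
apply: tspanD => //; exists [seq (c *: p.1, p.2) | p <- s]; split.
  by move=> p /mapP[q qs ->]; apply/PZ/sP.
by rewrite big_map scaler_sumr; apply: eq_bigr => p _; rewrite tensZl.
Qed.

Lemma tspan_ind (W : lmodType k) (F : {linear tensor A A -> W}) P (M : set W) t :
  M 0 -> (forall x y, M x -> M y -> M (x + y)) ->
  (forall a b, P a b -> M (F (a *t b))) -> tspan P t -> M (F t).
Proof.
move=> M0 MD MF [s [sP ->]]; rewrite linear_sum big_seq.
by apply: big_ind => // p /sP; apply: MF.
Qed.

Lemma tspan_bind (P Q : A -> A -> Prop) (F : {linear tensor A A -> tensor A A}) t :
  (forall a b, P a b -> tspan Q (F (a *t b))) -> tspan P t -> tspan Q (F t).
Proof. by move=> PQ; apply: tspan_ind => //; [apply: tspan0|apply: tspanD]. Qed.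

Lemma tspan_total t : tspan (fun _ _ => True) t.
Proof. by exists (repr t); split=> //; apply: tensor_repr_sum. Qed.

Fact mulr_is_linear (u : tensor A A) : linear (fun t => u * t).
Proof. by move=> c x y; rewrite mulrDr scalerAr. Qed.

Lemma tspan_mul P Q (R : A -> A -> Prop) t t' :
  (forall a b a' b', P a b -> Q a' b' -> R (a * a') (b * b')) ->
  tspan P t -> tspan Q t' -> tspan R (t * t').
Proof.
move=> PQR Pt Qt'; have [F FE] := exists_linear (mulr_is_linear t').
rewrite mulrC -FE; apply: tspan_bind Pt => a b Pab.
have [G GE] := exists_linear (mulr_is_linear (a *t b)).
rewrite FE mulrC -GE; apply: tspan_bind Qt' => a' b' Qab'.
by rewrite GE tensM; apply/tspan_tens/PQR.
Qed.

Definition slice mu : tensor A A -> A := tprod idfun (cst A mu).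

Fact slice_linear mu : linear (slice mu).
Proof. by move=> c x y; rewrite /slice linearP. Qed.

HB.instance Definition _ mu :=
  GRing.isLinear.Build k (tensor A A) A *:%R (slice mu) (slice_linear mu).

Lemma sliceE mu a b : slice mu (a *t b) = mu b *: a.
Proof. by rewrite /slice tprodE /= /cst mulr_algr. Qed.

Lemma tspan_ord P t : tspan P t -> exists m (a b : 'I_m -> A),
  (forall i, P (a i) (b i)) /\ t = \sum_i a i *t b i.
Proof.
move=> [s [sP ->]]; exists (size s), (fun i => (tnth (in_tuple s) i).1).
exists (fun i => (tnth (in_tuple s) i).2); split; last by rewrite big_tnth.
by move=> i; apply/sP/mem_tnth.
Qed.

Definition span (I : finType) (v : I -> A) : set A :=
  [set x | exists c : I -> k, x = \sum_i c i *: v i].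

Lemma span_subspace (I : finType) (v : I -> A) : subspace (span v).
Proof.
split; first by exists (fun=> 0); rewrite big1 // => i _; rewrite scale0r.
move=> d _ _ [c ->] [c' ->]; exists (fun i => d * c i + c' i).
by rewrite scaler_sumr -big_split; apply: eq_bigr => i _; rewrite scalerDl scalerA.
Qed.

Lemma span_mem (I : finType) (v : I -> A) i : span v (v i).
Proof.
exists (fun j => (j == i)%:R); rewrite (bigD1 i) //= eqxx scale1r big1 ?addr0 //.
by move=> j /negPf ->; rewrite scale0r.
Qed.

Definition addset (V : lmodType k) (X Y : set V) : set V :=
  [set z | exists x y, [/\ X x, Y y & z = x + y]].

Lemma addset_subspace (V : lmodType k) (X Y : set V) :
  subspace X -> subspace Y -> subspace (addset X Y).
Proof.
move=> sX sY; split.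
  by exists 0, 0; rewrite addr0; split=> //; apply: subspace0.
move=> c _ _ [x [y [Xx Yy ->]]] [x' [y' [Xx' Yy' ->]]].
exists (c *: x + x'), (c *: y + y').
by rewrite scalerDr addrACA; split=> //; [apply: sX.2|apply: sY.2].
Qed.

Lemma tens_sumr (I : finType) (P : pred I) (a : A) (b : I -> A) :
  a *t (\sum_(i | P i) b i) = \sum_(i | P i) a *t b i.
Proof. by elim/big_rec2: _ => [|i v w _ <-]; rewrite ?tens0r ?tensDr. Qed.

Lemma tens_suml (I : finType) (P : pred I) (a : I -> A) (b : A) :
  (\sum_(i | P i) a i) *t b = \sum_(i | P i) a i *t b.
Proof. by elim/big_rec2: _ => [|i v w _ <-]; rewrite ?tens0l ?tensDl. Qed.

(** Slices detect membership in [X (x) A + A (x) Y]: as long as the first right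
    factor is not a combination of the others modulo [Y], a functional isolates
    its left factor, which then lies in [X]; otherwise the tensor is shortened. *)
Lemma tensor_split (E X Y : set A) t :
  subspace E -> subspace X -> subspace Y ->
  tspan (fun a b => E a /\ E b) t ->
  (forall mu, (forall y, Y y -> mu y = 0) -> X (slice mu t)) ->
  tspan (fun a b => [/\ E a, E b & X a \/ Y b]) t.
Proof.
move=> subE subX subY /tspan_ord[m [a [b [abE ->]]]].
elim: m a b abE => [|m IHm] a b abE; first by rewrite big_ord0 => _; apply: tspan0.
rewrite big_ord_recl; set u := a ord0; set v := b ord0.
set a' := fun i => a (lift ord0 i); set b' := fun i => b (lift ord0 i).
have [Eu Ev] : E u /\ E v := abE ord0.
have abE' i : E (a' i) /\ E (b' i) := abE (lift ord0 i).
have slE mu (w : A) (d c : 'I_m -> A) : slice mu (w *t v + \sum_i d i *t c i) =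
    mu v *: w + \sum_i mu (c i) *: d i.
  by rewrite linearD /= sliceE linear_sum; congr (_ + _); apply: eq_bigr => i _; rewrite /= sliceE.
have [[_ [y [[c ->] Yy vE]]]|nZv] := pselect (addset (span b') Y v).
  have Ey : E y.
    rewrite -[y](addKr (\sum_i c i *: b' i)) addrC -vE.
    apply: subspaceB => //; apply: subspace_sum => // i _.
    by apply: subspaceZ => //; have [] := abE' i.
  have -> : u *t v + \sum_i a' i *t b' i =
      u *t y + \sum_i (a' i + c i *: u) *t b' i.
    rewrite vE tensDr [_ + u *t y]addrC -addrA tens_sumr -big_split; congr (_ + _).
    by apply: eq_bigr => i _; rewrite tensDl -tensZ addrC.
  move=> slX; apply: tspanD; first by apply: tspan_tens; split=> //; right.
  apply: IHm => [i|mu muY].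
    have [? ?] := abE' i; split=> //.
    by apply: subspaceD => //; apply: subspaceZ.
  by have := slX mu muY; rewrite linearD /= sliceE muY // scale0r add0r.
move=> slX; have subZ := addset_subspace (span_subspace b') subY.
have [mu [muZ muv]] := exists_functional subZ nZv.
have muY y : Y y -> mu y = 0.
  by move=> Yy; apply: muZ; exists 0, y; rewrite add0r; split=> //; exact: subspace0 (span_subspace _).
have mub i : mu (b' i) = 0.
  apply: muZ; exists (b' i), 0; rewrite addr0; split=> //; first exact: span_mem.
  exact: subspace0.
have Xu : X u.
  have := slX _ muY; rewrite slE muv scale1r big1 ?addr0 // => i _.
  by rewrite mub scale0r.
apply: tspanD; first by apply: tspan_tens; split=> //; left.
apply: IHm => // nu nuY; have := slX _ nuY; rewrite linearD /= sliceE => sX.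
rewrite -[slice _ _](addKr (nu v *: u)) addrC.
by apply: subspaceB => //; apply: subspaceZ.
Qed.

(** In a shortest expression of a tensor no left or right factor is a combination
    of the others, whence functionals dual to either family. *)
Lemma tensor_dual_bases (B : set A) t : subspace B ->
  tspan (fun a b => B a /\ B b) t ->
  exists m (a b : 'I_m -> A) (al be : 'I_m -> {scalar A}),
    [/\ forall i, B (a i) /\ B (b i), t = \sum_i a i *t b i,
        forall i j, al i (a j) = (i == j)%:R & forall i j, be i (b j) = (i == j)%:R].
Proof.
move=> subB /tspan_ord ext.
pose Q m := `[< exists a b : 'I_m -> A,
  (forall i, B (a i) /\ B (b i)) /\ t = \sum_i a i *t b i >].
have exQ : exists m, Q m.
  by have [m [a [b abP]]] := ext; exists m; apply/asboolP; exists a, b.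
case: (ex_minnP exQ) => m /asboolP[a [b [abB tE]]] minm {ext exQ}.
have dual (v : 'I_m -> A) :
    (forall i, ~ exists c : 'I_m -> k, v i = \sum_(j | j != i) c j *: v j) ->
    exists f : 'I_m -> {scalar A}, forall i j, f i (v j) = (i == j)%:R.
  move=> vP.
  have ex i : exists g : {scalar A}, (forall j, j != i -> g (v j) = 0) /\ g (v i) = 1.
    have [|mu [muZ mui]] := exists_functional (span_subspace
      (fun j : 'I_m => if j == i then 0 else v j)) (v := v i).
      case=> c vE; apply: (vP i); exists c; rewrite vE (bigD1 i) //= eqxx scaler0 add0r.
      by apply: eq_bigr => j /negPf ->.
    exists mu; split=> // j ji; apply: muZ.
    by have := span_mem (fun j : 'I_m => if j == i then 0 else v j) j; rewrite (negPf ji).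
  have [f fP] := choice ex.
  exists f => i j; have [->|ij] := eqVneq i j; first by have [] := fP j.
  by have [fij _] := fP i; rewrite fij // eq_sym.
have shorter i (a' b' : 'I_m -> A) : (forall j, B (a' j) /\ B (b' j)) ->
    t = \sum_(j | j != i) a' j *t b' j -> False.
  case: m minm i a' b' {a b abB tE dual} => [|m] minm i a' b' abB' tE.
    by case: i tE.
  suff /minm : Q m by rewrite ltnn.
  apply/asboolP; exists (a' \o lift i), (b' \o lift i); split=> [j|]; first exact: abB'.
  apply: (addrI (a' i *t b' i)); transitivity (\sum_j a' j *t b' j).
    by rewrite tE [RHS](bigD1 i).
  by rewrite (bigD1_ord i).
have [be beP] : exists f : 'I_m -> {scalar A}, forall i j, f i (b j) = (i == j)%:R.
  apply: dual => i [c bE]; apply: (shorter i (fun j => a j + c j *: a i) b).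
    move=> j; have [? ?] := abB j; have [? _] := abB i; split=> //.
    by apply: subspaceD => //; apply: subspaceZ.
  rewrite tE (bigD1 i) //= bE tens_sumr -big_split.
  by apply: eq_bigr => j _ /=; rewrite tensDl -tensZ addrC.
have [al alP] : exists f : 'I_m -> {scalar A}, forall i j, f i (a j) = (i == j)%:R.
  apply: dual => i [c aE]; apply: (shorter i a (fun j => b j + c j *: b i)).
    move=> j; have [? ?] := abB j; have [_ ?] := abB i; split=> //.
    by apply: subspaceD => //; apply: subspaceZ.
  rewrite tE (bigD1 i) //= aE tens_suml -big_split.
  by apply: eq_bigr => j _ /=; rewrite tensDr tensZ addrC.
by exists m, a, b, al, be.
Qed.
End TensorSpan.

(** * Finite subcoalgebras *)

Definition subalgebra (k : fieldType) (A : comAlgType k) (B : set A) : Prop :=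
  [/\ B 1, subspace B & forall x y, B x -> B y -> B (x * y)].

Lemma subalg_closedP (k : fieldType) (A : comAlgType k) (B : set A) :
  GRing.subalg_closed (fun x => x \in B) <-> subalgebra B.
Proof.
split=> [[B1 BZ BM]|[B1 [B0 BZ] BM]].
  have B'1 : B 1 by rewrite -in_setE.
  have B'Z c x y : B x -> B y -> B (c *: x + y).
    by move=> Bx By; rewrite -in_setE; apply: BZ; rewrite unfold_in in_setE.
  split=> //; last first.
    by move=> x y Bx By; rewrite -in_setE; apply: BM; rewrite unfold_in in_setE.
  by split=> //; have := B'Z (-1) _ _ B'1 B'1; rewrite scaleN1r addNr.
split=> [|c x y|x y]; rewrite ?unfold_in ?in_setE //; first exact: BZ.
exact: BM.
Qed.

Section FiniteSubcoalgebras.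
Variables (k : fieldType) (A : hopfAlgType k).
Implicit Types (B : set A) (x : A).

Lemma conv_sum (T : comAlgType k) (f g : {linear A -> T}) x (I : finType) (a b : I -> A) :
  comul x = \sum_i a i *t b i -> conv f g x = \sum_i f (a i) * g (b i).
Proof. by rewrite /conv => ->; rewrite linear_sum; apply: eq_bigr => i _; apply: tprodE. Qed.

Lemma counit_alg (c : k) : counit (c%:A : A) = c.
Proof. by rewrite linearZ /= rmorph1 mulr1. Qed.

Lemma conv_inr_cst (mu : {scalar A}) x :
  conv inr_tens (cst (tensor A A) mu) x = inr_tens (conv idfun (cst A mu) x).
Proof.
rewrite -[RHS]/((inr_tens \o conv idfun (cst A mu)) x) -conv_comp.
by apply: eq_conv => // y; rewrite /= /cst linearZ rmorph1.
Qed.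

Lemma conv_cst_lrmorphism (T : comAlgType k) (F : {lrmorphism A -> T}) (mu : {scalar A}) x :
  conv (cst T mu) F x = F (conv (cst A mu) idfun x).
Proof.
rewrite -[RHS]/((F \o conv (cst A mu) idfun) x) -conv_comp.
by apply: eq_conv => // y; rewrite /= /cst linearZ rmorph1.
Qed.

(** The left factors [a i] of a shortest expression of [comul x] span a comodule
    containing [x]; the entries [M] of its coaction lie in [B] because they are
    slices of coproducts of the right factors. *)
Lemma comatrix_coefficients B x : hopf_subalgebra B -> B x ->
  exists m (M : 'I_m -> 'I_m -> A), [/\ forall i j, B (M i j),
    forall i j, comul (M i j) = \sum_l M i l *t M l j,
    forall i j, counit (M i j) = (i == j)%:R &
    exists c : 'I_m -> 'I_m -> k, x = \sum_i \sum_j c i j *: M i j].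
Proof.
move=> [/subalg_closedP[B1 subB BM] BD _] Bx.
have [m [a [b [al [be [abB xE alP beP]]]]]] := tensor_dual_bases subB (BD x Bx).
pose M j i := slice (be i) (comul (b j)).
have aD i : comul (a i) = \sum_j a j *t M j i.
  transitivity (conv comul (cst (tensor A A) (be i)) x).
    rewrite (conv_sum _ _ xE) (bigD1 i) //= big1 ?addr0 => [|j ji].
      by rewrite /cst beP eqxx scale1r mulr1.
    by rewrite /cst beP eq_sym (negPf ji) scale0r mulr0.
  rewrite (eq_conv (@comul_conv _ A) (frefl _)) convA (conv_sum _ _ xE).
  apply: eq_bigr => j _; rewrite tens_mul; congr (_ * _).
  exact: conv_inr_cst.
have ME l i : M l i = conv (cst A (al l)) idfun (a i).
  rewrite (conv_sum _ _ (aD i)) (bigD1 l) //= big1 ?addr0 => [|j jl].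
    by rewrite /cst alP eqxx scale1r mul1r.
  by rewrite /cst alP eq_sym (negPf jl) scale0r mul0r.
exists m, M; split=> [i j|i j|i j|].
- have BDi : tspan (fun u v => B u /\ B v) (comul (b i)) := BD _ (abB i).2.
  apply: (tspan_ind (F := slice (be j)) (M := B) _ _ _ BDi).
  + exact: subspace0.
  + by move=> u v; apply: subspaceD.
  + by move=> u v [Bu Bv]; rewrite /= sliceE; apply: subspaceZ.
- rewrite ME.
  transitivity (conv (cst (tensor A A) (al i)) comul (a j)).
    exact/esym/conv_cst_lrmorphism.
  rewrite (eq_conv (frefl _) (@comul_conv _ A)) -convA (conv_sum _ _ (aD j)).
  apply: eq_bigr => l _; rewrite tens_mul; congr (_ * _).
  by rewrite /= conv_cst_lrmorphism ME.
- have := congr1 (al i) (conv_cstr (idfun : {linear A -> A}) (a j)).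
  rewrite (conv_sum _ _ (aD j)) /= alP => <-.
  rewrite [RHS]linear_sum [RHS](bigD1 i) //= [X in _ + X]big1 ?addr0 => [|l li].
    by rewrite /= /cst mulr_algr linearZ /= alP eqxx mulr1.
  by rewrite /= /cst mulr_algr linearZ /= alP eq_sym (negPf li) mulr0.
- exists (fun j i => counit (b i) * counit (a j)).
  rewrite exchange_big -[LHS](conv_cstr (idfun : {linear A -> A})) (conv_sum _ _ xE).
  apply: eq_bigr => i _; rewrite /= /cst mulr_algr.
  rewrite -[a i in LHS](conv_cstl (idfun : {linear A -> A}) (a i)) (conv_sum _ _ (aD i)).
  by rewrite scaler_sumr; apply: eq_bigr => j _; rewrite /cst mulr_algl scalerA.
Qed.

(** A comatrix is inverted by the matrix of its antipodes, so uniqueness of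
    inverse matrices computes [comul] and [antipode] on the latter. *)
Lemma comatrix_antipode m (M : 'I_m -> 'I_m -> A) :
  (forall i j, comul (M i j) = \sum_l M i l *t M l j) ->
  (forall i j, counit (M i j) = (i == j)%:R) ->
  forall i j,
    comul (antipode (M i j)) = \sum_l antipode (M l j) *t antipode (M i l) /\
    antipode (antipode (M i j)) = M i j.
Proof.
move=> MD Me.
pose X := \matrix_(i, j) M i j; pose Y := \matrix_(i, j) antipode (M i j).
have XY : X *m Y = 1%:M.
  apply/matrixP => i j; rewrite !mxE.
  have := conv_antipoder (idfun : {lrmorphism A -> A}) (M i j).
  rewrite (conv_sum _ _ (MD i j)) /cst Me scaler_nat => <-.
  by apply: eq_bigr => l _; rewrite !mxE.
have YX : Y *m X = 1%:M.
  apply/matrixP => i j; rewrite !mxE.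
  have := conv_antipodel (idfun : {lrmorphism A -> A}) (M i j).
  rewrite (conv_sum _ _ (MD i j)) /cst Me scaler_nat => <-.
  by apply: eq_bigr => l _; rewrite !mxE.
have uniq (T : comAlgType k) (P Q R : 'M[T]_m) : P *m Q = 1%:M -> Q *m R = 1%:M -> P = R.
  by move=> PQ QR; rewrite -[P]mulmx1 -QR mulmxA PQ mul1mx.
have SY : map_mx antipode Y = X.
  apply/esym/(uniq _ _ _ _ XY); rewrite [X in X *m _](_ : Y = map_mx antipode X).
    by rewrite -map_mxM XY map_mx1.
  by apply/matrixP => i j; rewrite !mxE.
have DY : map_mx inr_tens Y *m map_mx inl_tens Y = map_mx (comul : A -> tensor A A) Y.
  apply: (uniq _ _ (map_mx comul X)); last by rewrite -map_mxM XY map_mx1.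
  rewrite (_ : map_mx comul X = map_mx inl_tens X *m map_mx inr_tens X).
    rewrite mulmxA -(mulmxA (map_mx inr_tens Y)) -map_mxM YX map_mx1 mulmx1.
    by rewrite -map_mxM YX map_mx1.
  apply/matrixP => i j; rewrite !mxE MD; apply: eq_bigr => l _.
  by rewrite !mxE tens_mul.
move=> i j; split; last by move/matrixP/(_ i j): SY; rewrite !mxE.
move/matrixP/(_ i j): DY; rewrite !mxE => <-; apply: eq_bigr => l _.
by rewrite !mxE tens_mul mulrC.
Qed.

(** Local finiteness: the entries of a comatrix together with their antipodes span
    a subcoalgebra stable under the antipode. *)
Lemma finite_hopf_hull B (L : seq A) : hopf_subalgebra B ->
  (forall x, x \in L -> B x) ->
  exists G : seq A, [/\ forall g, g \in G -> B g,
    forall g, g \in G -> tspan (fun a b => a \in G /\ b \in G) (comul g),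
    forall g, g \in G -> antipode g \in G &
    forall V, subspace V -> (forall g, g \in G -> V g) -> forall x, x \in L -> V x].
Proof.
move=> hB; elim: L => [|x L IHL] LB; first by exists [::].
have [|G [GB GD GS GL]] := IHL; first by move=> y yL; apply: LB; rewrite inE yL orbT.
have [m [M [MB MD Me [c xE]]]] := comatrix_coefficients hB (LB x (mem_head _ _)).
have MS := comatrix_antipode MD Me.
pose ms := [seq M p.1 p.2 | p : 'I_m * 'I_m].
pose ss := [seq antipode (M p.1 p.2) | p : 'I_m * 'I_m].
have msP i j : M i j \in ms by apply: (map_f (fun p => M p.1 p.2)) (mem_enum _ (i, j)).
have ssP i j : antipode (M i j) \in ss.
  by apply: (map_f (fun p => antipode (M p.1 p.2))) (mem_enum _ (i, j)).
have sum_tspan (P : A -> A -> Prop) (u v : 'I_m -> A) :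
    (forall l, P (u l) (v l)) -> tspan P (\sum_l u l *t v l).
  move=> Puv; apply: big_ind => [||l _]; [exact: tspan0|exact: tspanD|].
  exact: tspan_tens.
exists (ms ++ ss ++ G); split=> [g|g|g|V sV VG y].
- rewrite !mem_cat => /or3P[/mapP[p _ ->]|/mapP[p _ ->]|/GB //]; first exact: MB.
  by have [_ _] := hB; apply; apply: MB.
- rewrite !mem_cat => /or3P[/mapP[p _ ->]|/mapP[p _ ->]|/GD].
  + by rewrite MD; apply: sum_tspan => l; rewrite !mem_cat !msP.
  + by rewrite (MS _ _).1; apply: sum_tspan => l; rewrite !mem_cat !ssP !orbT.
  + by apply: tspan_le => a b [aG bG]; rewrite !mem_cat aG bG !orbT.
- rewrite !mem_cat => /or3P[/mapP[p _ ->]|/mapP[p _ ->]|/GS ->]; last by rewrite !orbT.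
  + by rewrite ssP orbT.
  + by rewrite (MS _ _).2 msP.
- rewrite inE => /predU1P[->|yL].
    rewrite xE; apply: subspace_sum => // i _; apply: subspace_sum => // j _.
    by apply: subspaceZ => //; apply: VG; rewrite mem_cat msP.
  by apply: GL => // g gG; apply: VG; rewrite !mem_cat gG !orbT.
Qed.

End FiniteSubcoalgebras.

(** * Local retractions onto a Hopf subalgebra *)

Section MaximalMinors.
Variables (k : fieldType) (A : comAlgType k).

Definition ideal (I : set A) : Prop := subspace I /\ forall a x, I x -> I (a * x).

Lemma subalgebra_prod (D : set A) (J : Type) (r : seq J) (P : pred J) (F : J -> A) :
  subalgebra D -> (forall i, P i -> D (F i)) -> D (\prod_(i <- r | P i) F i).
Proof. by case=> D1 _ DM DF; apply: big_ind. Qed.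

Lemma subalgebra_sign (D : set A) m : subalgebra D -> D ((-1) ^+ m).
Proof.
case=> D1 subD DM; elim: m => [|m IHm]; first by rewrite expr0.
by rewrite exprS; apply: DM => //; apply: subspaceN.
Qed.

Lemma subalgebra_det (D : set A) r (M : 'M[A]_r) :
  subalgebra D -> (forall i j, D (M i j)) -> D (\det M).
Proof.
move=> sD DM; have [D1 subD DMM] := sD.
apply: subspace_sum => // s _; apply: DMM; last exact: subalgebra_prod.
exact: subalgebra_sign.
Qed.

(** Cramer's rule with the largest nonzero minors: if the relations [R] hold
    among the [v q] modulo [I] and [v o = 1], a minor of maximal size avoiding
    the column [o], bordered by that column and by a row of unknowns, is a
    linear form killing [R] whose value at the [o]-th basis vector is the minor
    itself. *)
Lemma maximal_minor (I D : set A) (O : finType) (o : O) (v : O -> A)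
    (R : set (O -> A)) :
  ideal I -> subalgebra D -> ~ I 1 -> v o = 1 ->
  (forall c, R c -> I (\sum_q c q * v q)) ->
  (forall c q, R c -> D (c q)) ->
  exists u : O -> A, [/\ forall q, D (u q), ~ I (u o) &
    forall c, R c -> I (\sum_q u q * c q)].
Proof.
move=> [subI IM] sD nI1 vo RI RD; have [D1 subD DM] := sD.
pose minor r (rho : 'I_r -> O -> A) (J : 'I_r -> O) := \det (\matrix_(l, p) rho l (J p)).
pose Q r := `[< exists (rho : 'I_r -> O -> A) (J : 'I_r -> O),
  [/\ forall l, R (rho l), forall p, J p != o & ~ I (minor r rho J)] >].
have Q0 : Q 0.
  apply/asboolP; exists (fun=> v), (fun=> o); split=> [[]|[]|] //.
  by rewrite /minor det_mx00.
have Qle r : Q r -> (r <= #|O|)%N.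
  move=> /asboolP[rho [J [_ _ nI]]]; rewrite leqNgt; apply/negP => ltOr.
  have [/injectiveP/leq_card|/injectivePn] := boolP (injectiveb J).
    by rewrite card_ord leqNgt ltOr.
  case=> p [p' pp' Jpp']; apply: nI.
  rewrite /minor -det_tr (determinant_alternate pp') => [|l]; last by rewrite !mxE Jpp'.
  exact: subspace0.
case: (ex_maxnP (ex_intro (fun r => is_true (Q r)) 0%N Q0) Qle) => r /asboolP[rho [J [Rrho Jo nI]]] maxr.
(* The row [ord0] carries the unknowns [c] and the column [ord0] the index [q]. *)
pose rows c (l : 'I_r.+1) : O -> A := oapp rho c (unlift ord0 l).
pose cols q (p : 'I_r.+1) : O := oapp J q (unlift ord0 p).
pose M c q := \matrix_(l, p) rows c l (cols q p).
have rows0 c : rows c ord0 = c by rewrite /rows unlift_none.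
have rowsS c l : rows c (lift ord0 l) = rho l by rewrite /rows liftK.
have cols0 q : cols q ord0 = q by rewrite /cols unlift_none.
have colsS q p : cols q (lift ord0 p) = J p by rewrite /cols liftK.
pose cof p := cofactor (M (fun=> 0) o) ord0 p.
have cofE c p : cofactor (M c o) ord0 p = cof p.
  rewrite /cof /cofactor; congr (_ * \det _); apply/matrixP => i j.
  by rewrite !mxE !rowsS.
have cofE' c q l : cofactor (M c q) l ord0 = cofactor (M c o) l ord0.
  rewrite /cofactor; congr (_ * \det _); apply/matrixP => i j.
  by rewrite !mxE !colsS.
(* For a relation [c], the bordered minors with [q] instead of [o] vanish by
   maximality, and their combination with coefficients [v q] vanishes by
   expansion along the column [q]; as [v o = 1], only the one with [o] is left. *)
have detM c : R c -> I (\det (M c o)).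
  move=> Rc; have Rrows l : R (rows c l) by rewrite /rows; case: unliftP => [j _|_] /=.
  have : I (\sum_q \det (M c q) * v q).
    rewrite (eq_bigr (fun q => \sum_l cofactor (M c o) l ord0 * (rows c l q * v q))).
      rewrite exchange_big; apply: subspace_sum => // l _.
      by rewrite -mulr_sumr; apply/IM/RI.
    move=> q _; rewrite (expand_det_col _ ord0) mulr_suml; apply: eq_bigr => l _.
    by rewrite cofE' mxE cols0 mulrAC mulrC.
  rewrite (bigD1 o) //= vo mulr1 => Isum.
  rewrite -[\det _](addrK (\sum_(q | q != o) \det (M c q) * v q)).
  apply: subspaceB => //; apply: subspace_sum => // q qo; rewrite mulrC; apply: IM.
  have [//|nIq] := pselect (I (\det (M c q))); exfalso.
  suff /maxr : Q r.+1 by rewrite ltnn.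
  by apply/asboolP; exists (rows c), (cols q); split=> // p; rewrite /cols; case: unliftP => [j _|_] /=.
have Dcof p : D (cof p).
  apply: DM; first exact: subalgebra_sign.
  apply: subalgebra_det => // i j; rewrite !mxE rowsS; exact: RD.
exists (fun q => \sum_(p | cols o p == q) cof p); split=> [q||c Rc].
- exact: subspace_sum.
- rewrite (bigD1 ord0) ?cols0 //= big1 ?addr0 => [|p /andP[]].
    rewrite /cof /cofactor expr0 mul1r => Iu; apply: nI; congr (I (\det _)): Iu.
    by apply/matrixP => i j; rewrite !mxE rowsS colsS.
  by rewrite /cols; case: unliftP => [p' _ /=|->]; [rewrite (negPf (Jo p'))|rewrite eqxx].
- congr I: (detM c Rc); rewrite (expand_det_row _ ord0).
  rewrite (partition_big (cols o) xpredT) //=; apply: eq_bigr => q _.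
  rewrite mulr_suml; apply: eq_bigr => p /eqP <-.
  by rewrite cofE mxE rows0 mulrC.
Qed.

End MaximalMinors.

Section LocalRetractions.
Variables (k : fieldType) (A : hopfAlgType k).
Implicit Types (D I : set A).

(** For a subspace [X] this is the kernel of [A (x) A -> A/X (x) A/X]. *)
Definition tor (X : set A) : set (tensor A A) := tspan (fun a b => X a \/ X b).

Definition hopf_ideal I : Prop :=
  [/\ ideal I, forall x, I x -> counit x = 0, forall x, I x -> I (antipode x) &
      forall x, I x -> tor I (comul x)].

Lemma tprodM (T : comAlgType k) (f g : {lrmorphism A -> T}) :
  {morph tprod f g : s t / s * t}.
Proof.
move=> s t; rewrite (tensor_repr_sum s) (tensor_repr_sum t) mulr_suml !linear_sum.
rewrite mulr_suml; apply: eq_bigr => p _; rewrite mulr_sumr linear_sum mulr_sumr.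
by apply: eq_bigr => q _; rewrite /= tensM !tprodE !rmorphM mulrACA.
Qed.

Lemma slice_mulr (mu : {scalar A}) t a :
  slice mu (t * inl_tens a) = slice mu t * a.
Proof.
rewrite (tensor_repr_sum t) mulr_suml !linear_sum mulr_suml; apply: eq_bigr => p _ /=.
by rewrite tensM !sliceE mulr1 scalerAl.
Qed.

Lemma counit_slice (mu : {scalar A}) x : counit (slice mu (comul x)) = mu x.
Proof.
rewrite -[in RHS](counitl x) /tensor_lift linear_sum [RHS]linear_sum.
by apply: eq_bigr => p _; rewrite /cst mulr_algr !linearZ /= mulrC.
Qed.

Lemma tor_mul I t t' : ideal I -> tor I t -> tor I (t' * t).
Proof.
move=> [_ IM] It; apply: tspan_mul (tspan_total t') It => a b a' b' _.
by case=> ?; [left|right]; apply: IM.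
Qed.

Lemma slice_tor I (mu : {scalar A}) t : subspace I -> (forall x, I x -> mu x = 0) ->
  tor I t -> I (slice mu t).
Proof.
move=> subI muI It; apply: (tspan_ind (F := slice mu) (M := I) _ _ _ It).
- exact: subspace0.
- by move=> x y; apply: subspaceD.
- move=> a b; rewrite /= sliceE => -[Ia|/muI ->]; first exact: subspaceZ.
  by rewrite scale0r; apply: subspace0.
Qed.

Lemma slice_left D (mu : {scalar A}) t : subspace D ->
  tspan (fun a b => D a) t -> D (slice mu t).
Proof.
move=> subD Dt; apply: (tspan_ind (F := slice mu) (M := D) _ _ _ Dt).
- exact: subspace0.
- by move=> x y; apply: subspaceD.
- by move=> a b; rewrite /= sliceE => Da; apply: subspaceZ.
Qed.

Lemma tspan_inr (b : A) : tspan (fun a _ => a = 1) (inr_tens b : tensor A A).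
Proof. exact: tspan_tens. Qed.

Section Comodule.
(* [D v] is a Hopf module: a [D]-module spanned by a right coideal. *)
Variables (D I : set A) (O : finType) (o : O) (v : O -> A) (m : O -> O -> A).
Hypotheses (hD : hopf_subalgebra D) (hI : hopf_ideal I).
Hypothesis vD : forall j, comul (v j) = \sum_i v i *t m i j.
Hypothesis mo : forall i, m i o = (i == o)%:R.

Definition relation (c : O -> A) : Prop :=
  (forall q, D (c q)) /\ I (\sum_q c q * v q).

(** The forms [u] that factor through [D v], modulo [I]. *)
Definition coform (u : O -> A) : Prop :=
  (forall q, D (u q)) /\ forall c, relation c -> I (\sum_q u q * c q).

Let subalgD : subalgebra D. Proof. by apply/subalg_closedP; case: hD. Qed.
Let subD : subspace D. Proof. by case: subalgD. Qed.
Let subI : subspace I. Proof. by case: hI => -[]. Qed.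

Lemma comul_sub x : D x -> tspan (fun a b => D a /\ D b) (comul x).
Proof. by case: hD => _ + _; apply. Qed.

(** The coaction on [Hom_D (D v, D)] induced by those on [D v] and [D]: if
    [phi] is [D]-linear then so is [v j |-> phi(v i)_1 (x) phi(v i)_2 S(m i j)].
    Checking it on a relation [c] uses that the relations themselves are
    costable, and that [c_1 (x) c_2 S(c_3) = c (x) 1]. *)
Lemma coform_costable (u : O -> A) (lam : {scalar A}) :
  coform u -> (forall x, I x -> lam x = 0) ->
  coform (fun j => slice lam (\sum_i comul (u i) * inr_tens (antipode (m i j)))).
Proof.
move=> [uD uR] lamI; have [[_ IM] _ IS IC] := hI; split=> [j|c [cD cI]].
  apply: slice_left => //; apply: big_ind => [||i _]; [exact: tspan0|exact: tspanD|].
  apply: tspan_mul (comul_sub (uD i)) (tspan_inr _) => //.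
  by move=> a b a' b' [Da _] ->; rewrite mulr1.
pose z i := \sum_j comul (c j) * inr_tens (m i j).
pose y := \sum_i z i * inl_tens (u i).
have zD i : tspan (fun a b => D a) (z i).
  apply: big_ind => [||j _]; [exact: tspan0|exact: tspanD|].
  apply: tspan_mul (comul_sub (cD j)) (tspan_inr _) => //.
  by move=> a b a' b' [Da _] ->; rewrite mulr1.
have zI : tor I (\sum_i z i * inl_tens (v i)).
  suff -> : \sum_i z i * inl_tens (v i) = comul (\sum_j c j * v j) by apply: IC.
  under eq_bigr do rewrite mulr_suml; rewrite exchange_big linear_sum /=.
  apply: eq_bigr => j _; rewrite rmorphM /= vD mulr_sumr; apply: eq_bigr => i _.
  by rewrite tens_mul mulrA mulrAC.
(* Every slice of [z] is again a relation, hence is killed by [u]. *)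
have yI : tor I y.
  have split_le : forall a b, [/\ setT a, setT b & I a \/ I b] -> I a \/ I b by move=> a b [].
  apply: tspan_le split_le _; apply: tensor_split => //.
    by apply: tspan_le (tspan_total _).
  move=> mu muI; rewrite linear_sum; under eq_bigr do rewrite /= slice_mulr mulrC.
  apply: uR; split=> [q|]; first exact: slice_left.
  have := slice_tor subI muI zI; rewrite linear_sum.
  by under eq_bigr do rewrite /= slice_mulr.
(* [Psi (a (x) b) = a_1 (x) a_2 S(b)] undoes the coproduct of [c j] in [z i]. *)
pose Psi := tprod comul (inr_tens \o antipode) : tensor A A -> tensor A A.
have PsiM s t : Psi (s * t) = Psi s * Psi t by exact: tprodM.
have PsiD a : Psi (comul a) = inl_tens a.
  transitivity (conv (conv inl_tens inr_tens) (inr_tens \o antipode) a).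
    by apply: eq_conv => // x; apply: comul_conv.
  rewrite convA -[RHS](conv_cstr (inl_tens : {linear A -> tensor A A})).
  by apply: eq_conv => // x; apply: conv_antipoder.
have PsiI : tor I (Psi y).
  apply: tspan_bind yI => a b [Ia|Ib]; rewrite /= tprodE.
    by rewrite mulrC; apply: tor_mul; [case: hI|apply: IC].
  apply: tor_mul; first by case: hI.
  by apply: tspan_tens; right; apply: IS.
have -> : \sum_q slice lam (\sum_i comul (u i) * inr_tens (antipode (m i q))) * c q =
    slice lam (Psi y).
  under eq_bigr do rewrite -slice_mulr mulr_suml.
  rewrite -linear_sum exchange_big; congr slice.
  rewrite /Psi /y linear_sum; apply: eq_bigr => i _.
  rewrite [RHS]PsiM /Psi /z linear_sum mulr_suml.
  apply: eq_bigr => j _.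
  transitivity (inl_tens (c j) * inr_tens (antipode (m i j)) * comul (u i)).
    by rewrite mulrC [comul _ * _]mulrC mulrA.
  congr (_ * _); last by rewrite [RHS]tprodE /= !rmorph1 mulr1.
  by rewrite [RHS]PsiM PsiD [Psi _]tprodE !rmorph1 mul1r.
exact: slice_tor.
Qed.

(** The values [u o] of the forms make up an ideal of [D], nonzero modulo [I]
    by [maximal_minor] and costable; an ideal of a Hopf algebra that is
    costable and nonzero is the whole algebra. *)
Lemma unit_coform : v o = 1 -> exists u, coform u /\ u o = 1.
Proof.
move=> vo; have [[_ IM] Ie IS IC] := hI; have [D1 _ DM] := subalgD.
pose T := [set x | exists u, coform u /\ u o = x].
have subT : subspace T.
  split.
    exists (fun=> 0); split=> //; split=> [q|c _]; first exact: subspace0.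
    by rewrite big1 => [|q _]; [apply: subspace0|rewrite mul0r].
  move=> c _ _ [u [[uD uR] <-]] [u' [[uD' uR'] <-]].
  exists (fun q => c *: u q + u' q); split=> //; split=> [q|d dR]; first exact: subD.2.
  under eq_bigr do rewrite mulrDl -scalerAl.
  by rewrite big_split -scaler_sumr; apply: subI.2; [apply: uR|apply: uR'].
have TM d x : D d -> T x -> T (d * x).
  move=> Dd [u [[uD uR] <-]]; exists (fun q => d * u q); split=> //.
  split=> [q|c cR]; first exact: DM.
  under eq_bigr do rewrite -mulrA.
  by rewrite -mulr_sumr; apply/IM/uR.
have TI d : D d -> I d -> T d.
  move=> Dd Id; exists (fun q => if q == o then d else 0); rewrite eqxx; split=> //.
  split=> [q|c _]; first by case: ifP => // _; apply: subspace0.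
  apply: subspace_sum => // q _; rewrite mulrC; apply: IM; case: ifP => // _.
  exact: subspace0.
have nI1 : ~ I 1 by move=> /Ie; rewrite rmorph1 => /eqP; rewrite oner_eq0.
have [|c [_] //|c q [cD _] //|u [uD nIu uR]] :=
  maximal_minor (R := relation) _ subalgD nI1 vo; first by case: hI.
(* As [y] in [T] has counit [1], the ideal [T] contains [1 = y_1 S(y_2)]. *)
have [lam [lamI lamu]] := exists_functional subI nIu.
have Tslice x (mu : {scalar A}) : T x -> (forall a, I a -> mu a = 0) ->
    T (slice mu (comul x)).
  move=> [w [wC <-]] muI; eexists; split; first exact: coform_costable wC muI.
  congr slice; rewrite (bigD1 o) //= big1 => [|i /negPf io].
    by rewrite mo eqxx !rmorph1 addr0 mulr1.
  by rewrite mo io !rmorph0 mulr0.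
pose y := slice lam (comul (u o)).
have Ty : T y by apply: Tslice => //; exists u; split=> //; split.
have ey : counit y = 1 by rewrite /y counit_slice.
have Dy : D y by case: Ty => w [[wD _] <-].
have Dy2 := tensor_split subD subT subI (comul_sub Dy) (fun mu => Tslice y mu Ty).
suff : T (conv idfun antipode y) by rewrite (conv_antipoder (idfun : {lrmorphism A -> A})) /cst ey scale1r.
apply: (tspan_ind (F := tprod idfun antipode) (M := T) _ _ _ Dy2).
- exact: subspace0.
- by move=> a b; apply: subspaceD.
- have [_ _ DS] := hD.
  move=> a b [Da Db [Ta|Ib]]; rewrite /= tprodE /=.
    by rewrite mulrC; apply: TM => //; apply: DS.
  by apply: TM => //; apply: TI; [apply: DS|apply: IS].
Qed.

End Comodule.
End LocalRetractions.

Section Descent.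
Variables (k : fieldType) (A : hopfAlgType k).
Implicit Types (B C D E I M : set A).

Lemma hopf_subalgebraT : hopf_subalgebra [set: A].
Proof.
split=> //; first by apply/subalg_closedP; split=> //; split.
move=> b _; have [s [_ sE]] := tspan_total (comul b).
by exists s; split=> // p _; split.
Qed.

(** Put differently, [A] is a directed union of finite right coideals containing [1]. *)
Lemma finite_coideal (L : seq A) :
  exists (O : finType) (o : O) (v : O -> A) (m : O -> O -> A),
  [/\ forall j, comul (v j) = \sum_i v i *t m i j, v o = 1,
      forall i, m i o = (i == o)%:R & forall x, x \in L -> span v x].
Proof.
have [//|G [_ GD _ GL]] := finite_hopf_hull (L := L) hopf_subalgebraT.
pose O : finType := option 'I_(size G); pose v (q : O) := oapp (tnth (in_tuple G)) 1 q.
have vG g : g \in G -> exists q, v q = g.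
  by move=> gG; have /tnthP[i ->] : g \in in_tuple G := gG; exists (Some i).
have exm (j : O) : exists m : O -> A, comul (v j) = \sum_i v i *t m i /\
    (j = None -> forall i, m i = (i == None)%:R).
  case: j => [j|] /=; last first.
    exists (fun i => (i == None)%:R); split=> //.
    rewrite rmorph1 (bigD1 None) //= big1 ?addr0 // => i /negPf ->.
    by rewrite tens0r.
  suff [m mE] : exists m : O -> A, comul (tnth (in_tuple G) j) = \sum_i v i *t m i.
    by exists m.
  pose Z := [set t | exists m : O -> A, t = \sum_i v i *t m i].
  apply: (tspan_ind (F := idfun) (M := Z) _ _ _ (GD _ (mem_tnth j (in_tuple G)))).
  - by exists (fun=> 0); rewrite big1 // => i _; rewrite tens0r.
  - move=> _ _ [m ->] [m' ->]; exists (fun i => m i + m' i).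
    by rewrite -big_split; apply: eq_bigr => i _; rewrite tensDr.
  - move=> _ b [/vG[q <-] _]; exists (fun i => if i == q then b else 0).
    rewrite (bigD1 q) //= eqxx big1 ?addr0 // => i /negPf ->.
    by rewrite tens0r.
have [m mP] := choice exm.
exists O, None, v, (fun i j => m j i); split=> // [j|i|x xL].
- by have [] := mP j.
- by have [_ ->] := mP None.
- apply: GL xL; first exact: span_subspace.
  by move=> g /vG[q <-]; apply: span_mem.
Qed.

(** A [k]-linear map [A -> D] inducing [D]-linear maps [A/I -> D/(D & I)] as far
    as multiples of the elements of [L] are concerned, and the identity on [D]. *)
Definition local_retraction D I (L : seq A) (pi : A -> A) : Prop :=
  [/\ forall x, D (pi x), forall x, I x -> I (pi x), I (pi 1 - 1) &
      forall y, y \in L -> forall d, D d -> I (pi (d * y) - d * pi y)].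

(** A form of value [1] at [v o = 1] that respects the relations among the [v q]
    modulo [I] is a retraction on the [D]-module spanned by the [v q]. *)
Theorem exists_local_retraction D I L : hopf_subalgebra D -> hopf_ideal I ->
  exists pi : {linear A -> A}, local_retraction D I L pi.
Proof.
move=> hD hI; have [O [o [v [m [vD vo mo Lv]]]]] := finite_coideal L.
have [u [[uD uR] uo]] := unit_coform hD hI vD mo vo.
have [D1 subD DM] : subalgebra D by apply/subalg_closedP; case: hD.
have [[subI IM] _ _ _] := hI.
pose G := [set xy : A * A | exists c : O -> A, [/\ forall q, D (c q),
  I (xy.1 - \sum_q c q * v q), D xy.2 & I (xy.2 - \sum_q u q * c q)]].
have subG : subspace G.
  split.
    exists (fun=> 0); rewrite !big1 => [|q _|q _]; rewrite ?mulr0 ?mul0r //.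
    by split=> /= *; rewrite ?subrr; apply: subspace0.
  move=> a [x x'] [y y'] [c [cD /= cI Dx cu]] [d [dD /= dI Dy du]].
  exists (fun q => a *: c q + d q); split=> [q||//=|] /=; try exact: subD.2.
    under eq_bigr do rewrite mulrDl -scalerAl.
    by rewrite big_split -scaler_sumr opprD addrACA -scalerBr; apply: subI.2.
  under eq_bigr do rewrite mulrDr -scalerAr.
  by rewrite big_split -scaler_sumr opprD addrACA -scalerBr; apply: subI.2.
have Guniq x y x' y' : G (x, y) -> G (x', y') -> I (x - x') -> I (y - y').
  move=> [c [cD cI _ cu]] [d [dD dI _ du]] Ixx'.
  have Icd : I (\sum_q u q * (c q - d q)).
    apply: uR; split=> [q|]; first exact: subspaceB.
    under eq_bigr do rewrite mulrBl; rewrite sumrB.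
    have -> : \sum_q c q * v q - \sum_q d q * v q =
      (x' - \sum_q d q * v q) - (x - \sum_q c q * v q) + (x - x').
      by rewrite opprB addrA -[X in X - x']addrA subrK [RHS]addrC !addrA addNr add0r addrC.
    by apply: subspaceD => //; apply: subspaceB.
  have -> : y - y' = (y - \sum_q u q * c q) - (y' - \sum_q u q * d q) +
      \sum_q u q * (c q - d q).
    rewrite (_ : \sum_q u q * (c q - d q) = \sum_q u q * c q - \sum_q u q * d q).
      by rewrite opprB addrAC !addrA !subrK.
    by rewrite -sumrB; apply: eq_bigr => q _; rewrite mulrBr.
  by apply: subspaceD => //; apply: subspaceB.
have Gv d q : D d -> G (d * v q, d * u q).
  move=> Dd; exists (fun p => if p == q then d else 0).
  have sum1 (f : O -> A) : \sum_p f p * (if p == q then d else 0) = d * f q.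
    rewrite (bigD1 q) //= eqxx big1 ?addr0 1?mulrC // => p /negPf ->.
    by rewrite mulr0.
  split=> [p||//|]; last 1 first.
  - by rewrite sum1 subrr; apply: subspace0.
  - by case: ifP => // _; apply: subspace0.
  - by under eq_bigr do rewrite mulrC; rewrite sum1 subrr; apply: subspace0.
  - exact: DM.
have [pi [piG piD]] := linear_selection subG.
exists pi; split=> [x|x Ix||y /Lv].
- by have [x' [c []]] := piD x.
- rewrite -[pi x]subr0; apply: (Guniq x _ 0 0); last by rewrite subr0.
    apply: (piG x 0); exists (fun=> 0); rewrite !big1 => [|q _|q _]; rewrite ?mulr0 ?mul0r //.
    by rewrite !subr0 /=; split=> // *; apply: subspace0.
  exact: subspace0 subG.
- have G11 : G (1, 1) by have := Gv 1 o D1; rewrite vo uo mulr1.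
  by apply: Guniq (piG _ _ G11) G11 _; rewrite subrr; apply: subspace0.
- case=> c -> d Dd; rewrite mulr_sumr !linear_sum mulr_sumr -sumrB.
  apply: subspace_sum => // q _; rewrite /= -scalerAr !linearZ /= -scalerAr -scalerBr.
  apply: subspaceZ => //; have Gd := piG _ _ (Gv d q Dd).
  have [e [eD eI Dpi eu]] : G (v q, pi (v q)).
    by apply: piG (u q) _; have := Gv 1 q D1; rewrite !mul1r.
  apply: (Guniq (d * v q) _ (d * v q)) Gd _ _; last by rewrite subrr; apply: subspace0.
  exists (fun p => d * e p); split=> [p|||]; try exact: DM.
    under eq_bigr do rewrite -mulrA.
    by rewrite -mulr_sumr -mulrBr; apply: IM.
  under eq_bigr do rewrite mulrCA.
  by rewrite -mulr_sumr -mulrBr; apply: IM.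
Qed.
End Descent.

(** * Faithfully flat descent *)

Section Galois.
Variables (k : fieldType) (A : hopfAlgType k).
Implicit Types (B C D E I M : set A).

(** The ideal of the kernel of the quotient map of groups given by [C]. *)
Definition aug C : set A := [set x | exists s : seq (A * A),
  (forall p, p \in s -> C p.1 /\ counit p.1 = 0) /\ x = \sum_(p <- s) p.1 * p.2].

Lemma aug_ideal C : ideal (aug C).
Proof.
have augM a x : aug C x -> aug C (a * x).
  move=> [s [sC ->]]; exists [seq (p.1, a * p.2) | p <- s]; split.
    by move=> _ /mapP[p ps ->] /=; apply: sC.
  by rewrite big_map mulr_sumr; apply: eq_bigr => p _; rewrite /= mulrCA.
split=> //; split=> [|c x y xC [s' [sC' ->]]]; first by exists [::]; rewrite big_nil.
have [s [sC cx]] : aug C (c *: x) by rewrite -mulr_algl; apply: augM.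
exists (s ++ s'); rewrite big_cat /= -cx; split=> // p.
by rewrite mem_cat => /orP[/sC|/sC'].
Qed.

Lemma aug_mem C x a : C x -> counit x = 0 -> aug C (x * a).
Proof.
move=> Cx ex; exists [:: (x, a)]; rewrite big_seq1; split=> // p.
by rewrite inE => /eqP ->.
Qed.

Lemma aug_le C C' x : (forall y, C y -> C' y) -> aug C x -> aug C' x.
Proof. by move=> CC' [s [sC ->]]; exists s; split=> // p /sC[/CC' ? ?]. Qed.

Lemma aug_ind C (J : set A) : ideal J -> (forall x, C x -> counit x = 0 -> J x) ->
  forall x, aug C x -> J x.
Proof.
move=> [subJ JM] CJ x [s [sC ->]]; apply: subspace_sum_seq => // p /sC[Cp ep].
by rewrite mulrC; apply/JM/CJ.
Qed.

(** [b |-> S(b_1) (x) b_2]. *)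
Definition antipode_coaction : A -> tensor A A := conv (inl_tens \o antipode) inr_tens.

Lemma antipode_coactionM : {morph antipode_coaction : x y / x * y}.
Proof. by move=> x y; rewrite /antipode_coaction /conv rmorphM tprodM. Qed.

Lemma antipode_coaction1 : antipode_coaction 1 = 1.
Proof. by rewrite /antipode_coaction /conv rmorph1 tprodE /= !rmorph1 mulr1. Qed.

Fact antipode_coaction_linear : linear antipode_coaction.
Proof. by move=> c x y; rewrite /antipode_coaction linearP. Qed.

HB.instance Definition _ :=
  GRing.isLinear.Build k A (tensor A A) *:%R antipode_coaction antipode_coaction_linear.

Lemma antipode_coaction_alg (c : k) : antipode_coaction c%:A = inl_tens (c%:A : A).
Proof. by rewrite linearZ [RHS]linearZ /= antipode_coaction1. Qed.

(** The inverse [a (x) b |-> a S(b_1) (x) b_2] of the map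
    [a (x) b |-> a b_1 (x) b_2] expressing that translation by a group acts
    simply transitively. *)
Definition galois : tensor A A -> tensor A A := tprod inl_tens antipode_coaction.

Fact galois_linear : linear galois.
Proof. by move=> c x y; rewrite /galois linearP. Qed.

HB.instance Definition _ :=
  GRing.isLinear.Build k (tensor A A) (tensor A A) *:%R galois galois_linear.

Lemma galoisE a b : galois (a *t b) = inl_tens a * antipode_coaction b.
Proof. by rewrite /galois tprodE. Qed.

Lemma galois_comul x : galois (comul x) = inr_tens x.
Proof.
transitivity (conv inl_tens (conv (inl_tens \o antipode) inr_tens) x) => //.
rewrite -convA -[RHS](conv_cstl (inr_tens : {linear A -> tensor A A})).
by apply: eq_conv => // y; apply: conv_antipoder.
Qed.

Section Kernel.
Variables D I M : set A.
Hypotheses (hD : hopf_subalgebra D) (hI : hopf_ideal I) (subM : subspace M).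
Hypothesis DM : forall d x, D d -> M x -> M (d * x).
Hypothesis DIM : forall a x, D x -> I x -> M (a * x).

(** Tensors of [A (x) A] that are killed by the maps induced by sufficiently good
    retractions. They include those that vanish in [A/I (x)_D A/M]. *)
Definition killed (t : tensor A A) : Prop := exists L : seq A,
  forall pi : {linear A -> A}, local_retraction D I L pi -> M (tprod pi idfun t).

Lemma killed_subspace : subspace killed.
Proof.
split=> [|c s t [L sL] [L' tL']].
  by exists [::] => pi _; rewrite linear0; apply: subspace0.
exists (L ++ L') => pi [piD piI pi1 piL]; rewrite linearP; apply: subM.2.
  by apply: sL; split=> // y yL; apply: piL; rewrite mem_cat yL.
by apply: tL'; split=> // y yL; apply: piL; rewrite mem_cat yL orbT.
Qed.

Lemma killed_l a b : I a -> killed (a *t b).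
Proof.
move=> Ia; exists [::] => pi [piD piI _ _]; rewrite tprodE /= mulrC.
by apply: DIM; [apply: piD|apply: piI].
Qed.

Lemma killed_r a b : M b -> killed (a *t b).
Proof.
by move=> Mb; exists [::] => pi [piD _ _ _]; rewrite tprodE /=; apply: DM.
Qed.

Lemma killed_balance a d b : D d -> killed ((d * a) *t b - a *t (d * b)).
Proof.
move=> Dd; exists [:: a] => pi [piD _ _ piL]; rewrite linearB /= !tprodE /=.
rewrite mulrA -mulrBl mulrC [pi a * d]mulrC; apply: DIM.
  have [_ subD DMM] : subalgebra D by apply/subalg_closedP; case: hD.
  by apply: subspaceB => //; apply: DMM.
by apply: piL; rewrite ?mem_head.
Qed.

(** Descent: a retraction [pi] of [D/(D & I) -> A/I] turns [1 (x) x] into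
    [pi 1 * x], which is [x] modulo [M]. *)
Lemma killed_unit x : killed (inr_tens x) -> M x.
Proof.
move=> [L xL]; have [pi piP] := exists_local_retraction L hD hI.
have := xL pi piP; rewrite tprodE /= => Mx; have [piD _ pi1 _] := piP.
have [D1 subD _] : subalgebra D by apply/subalg_closedP; case: hD.
have M1 : M (x * (pi 1 - 1)) by apply: DIM => //; apply: subspaceB.
have -> : x = pi 1 * x - x * (pi 1 - 1).
  by rewrite mulrBr mulr1 [x * _]mulrC opprB addrC subrK.
exact: subspaceB.
Qed.

Lemma killed_tor J t : (forall x, J x -> I x) -> (forall x, J x -> M x) ->
  tor J t -> killed t.
Proof.
move=> JI JM Jt; apply: (tspan_ind (F := idfun) (M := killed) _ _ _ Jt).
- exact: subspace0 killed_subspace.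
- by move=> x y; apply: (subspaceD killed_subspace).
- by move=> a b [/JI|/JM] ?; [apply: killed_l|apply: killed_r].
Qed.

Lemma killed_inl a t : I a -> killed (inl_tens a * t).
Proof.
have [[_ IM] _ _ _] := hI.
move=> Ia; rewrite (tensor_repr_sum t) mulr_sumr.
apply: subspace_sum => [|p _]; first exact: killed_subspace.
by rewrite tensM; apply: killed_l; rewrite mulrC; apply: IM.
Qed.

(** [S(d_1) (x) d_2] and [S(d_1) d_2 (x) 1 = e(d) (x) 1] agree over [D]. *)
Lemma killed_antipode_coaction d t :
  D d -> counit d = 0 -> killed (antipode_coaction d * t).
Proof.
have [_ DD DS] := hD.
move=> Dd ed; rewrite (tensor_repr_sum t) mulr_sumr.
apply: subspace_sum => [|p _]; first exact: killed_subspace.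
move: p.1 p.2 => a b {t p}.
have [|H HE] := @exists_linear k _ _ (fun t =>
  tprod (inl_tens \o antipode) inr_tens t * (a *t b) -
  inl_tens (tprod antipode idfun t) * (a *t b)).
  move=> c s t; rewrite !linearP !mulrDl -!scalerAl opprD addrACA.
  by rewrite scalerBr.
have : killed (H (comul d)).
  apply: (tspan_ind (M := killed) (P := fun x y => D x /\ D y)) (DD d Dd).
  - exact: subspace0 killed_subspace.
  - by move=> x y; apply: (subspaceD killed_subspace).
  - move=> x y [Dx Dy]; rewrite HE !tprodE /= -tens_mul !tensM mul1r.
    rewrite -opprB; apply: (subspaceN killed_subspace).
    by rewrite [antipode x * y]mulrC -[y * _ * _]mulrA; apply: killed_balance.
rewrite HE.
have -> : tprod antipode idfun (comul d) = 0.
  transitivity (conv antipode idfun d) => //.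
  by rewrite (conv_antipodel (idfun : {lrmorphism A -> A})) /cst ed scale0r.
by rewrite rmorph0 mul0r subr0.
Qed.

Lemma killed_aug a z : aug D z -> killed (inl_tens a * antipode_coaction z).
Proof.
move=> [s [sD ->]]; rewrite linear_sum mulr_sumr.
apply: subspace_sum_seq => [|p /sD[Dp ep]]; first exact: killed_subspace.
by rewrite /= antipode_coactionM mulrCA; apply: killed_antipode_coaction.
Qed.

End Kernel.

Lemma tor_antipode_coaction I x : hopf_ideal I -> I x -> tor I (antipode_coaction x).
Proof.
move=> [_ _ IS IC] Ix.
apply: (tspan_bind (F := tprod (inl_tens \o antipode) inr_tens)) (IC x Ix) => a b Iab.
rewrite /= tprodE /= -tens_mul; apply: tspan_tens.
by case: Iab => [/IS|]; [left|right].
Qed.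

(** For closed subgroups [H <= H'] (with ideals [I' <= I]): if [H] and [H'] have
    the same image under the quotient map given by [D], and the kernel of
    [H' -> Spec D] lies in [H], then [H = H']. Indeed the coproduct of an [x] in
    [I] lies in [I (x) A + A (x) (I' + aug D)], and [galois] maps it to
    [1 (x) x], which therefore vanishes in [A/I (x)_D A/I']. *)
Theorem hopf_ideal_descent D E I I' :
  hopf_subalgebra D -> hopf_subalgebra E -> hopf_ideal I -> hopf_ideal I' ->
  (forall x, I' x -> I x) -> (forall x, D x -> I x -> I' x) ->
  (forall x, E x -> I x -> addset I' (aug D) x) ->
  forall x, E x -> I x -> I' x.
Proof.
move=> hD hE hI hI' I'I DI EI x Ex Ix.
have [[subI _] _ _ IC] := hI; have [[subI' I'M] _ _ _] := hI'.
have [_ subE _] : subalgebra E by apply/subalg_closedP; case: hE.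
have I'DM d y : D d -> I' y -> I' (d * y) by move=> _; apply: I'M.
have I'DI a y : D y -> I y -> I' (a * y) by move=> Dy Iy; apply/I'M/DI.
have sK := killed_subspace D I subI'.
have Ex2 : tspan (fun a b => E a /\ E b) (comul x) by have [_ + _] := hE; apply.
apply: (killed_unit hD hI subI' I'DI); rewrite -galois_comul.
have := tensor_split subE subI subI Ex2 (fun mu muI => slice_tor subI muI (IC x Ix)).
apply: (tspan_ind (F := galois) (M := killed D I I')).
- exact: subspace0.
- by move=> s t; apply: subspaceD.
- move=> a b [Ea Eb]; rewrite /= galoisE => -[Ia|Ib]; first exact: killed_inl.
  have [y [z [I'y Dz ->]]] := EI b Eb Ib.
  rewrite linearD mulrDr; apply: subspaceD => //; last exact: killed_aug.
  apply: (killed_tor subI' I'DM I'DI (J := I')) => //.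
  by apply: tor_mul; [case: hI'|apply: tor_antipode_coaction].
Qed.

Lemma hopf_ideal0 : hopf_ideal [set 0 : A].
Proof.
split=> [|x ->|x ->|x ->]; rewrite ?rmorph0 //; last exact: tspan0.
split=> [|a x ->]; last by rewrite /= mulr0.
by split=> // c x y -> ->; rewrite /= scaler0 addr0.
Qed.

(** A quotient group is determined by its kernel: for [b] in [B] the difference
    [comul b - b (x) 1] lies in [A (x) aug C], and [galois] maps it to
    [1 (x) b - b (x) 1], which therefore vanishes in [A (x)_C A/C]. *)
Theorem hopf_subalgebra_descent B C : hopf_subalgebra B -> hopf_subalgebra C ->
  (forall x, B x -> counit x = 0 -> aug C x) -> forall x, B x -> C x.
Proof.
move=> hB hC BC b Bb; have h0 := hopf_ideal0.
have [C1 subC CM] : subalgebra C by apply/subalg_closedP; case: hC.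
have [B1 subB _] : subalgebra B by apply/subalg_closedP; case: hB.
have C0 a x : C x -> [set 0 : A] x -> C (a * x).
  by move=> _ ->; rewrite mulr0; apply: subspace0.
have sK := killed_subspace C [set 0] subC.
apply: (killed_unit hC h0 subC C0).
have [|H HE] := @exists_linear k _ _ (fun t =>
    galois t - inl_tens (tprod idfun (cst A counit) t)).
  by move=> c s t; rewrite !linearP addrACA scalerDr.
have KH : killed C [set 0] C (H (comul b)).
  have Bb2 : tspan (fun x y => B x /\ B y) (comul b) by have [_ + _] := hB; apply.
  apply: (tspan_ind (M := killed C [set 0] C) _ _ _ Bb2).
  - exact: subspace0.
  - by move=> s t; apply: subspaceD.
  - move=> x y [Bx By]; rewrite HE galoisE tprodE /= /cst rmorphM -mulrBr.
    rewrite [X in _ - X](_ : _ = antipode_coaction (counit y)%:A); last first.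
      exact/esym/antipode_coaction_alg.
    rewrite -(linearB antipode_coaction); apply: killed_aug => //; apply: BC.
      by apply: subspaceB => //; apply: subspaceZ.
    by rewrite rmorphB /= counit_alg subrr.
have <- : H (comul b) + b *t 1 = inr_tens b.
  rewrite HE galois_comul.
  by rewrite [tprod _ _ _](conv_cstr (idfun : {linear A -> A})) subrK.
by apply: subspaceD => //; apply: killed_r.
Qed.

End Galois.

(** * Dickson's lemma *)

Section Dickson.

(** The form with nondecreasing subsequences makes products immediate. *)
Definition well_quasi_order (T : Type) (R : T -> T -> Prop) : Prop :=
  forall f : nat -> T, exists s : nat -> nat,
    (forall i j, (i < j)%N -> (s i < s j)%N) /\
    forall i j, (i <= j)%N -> R (f (s i)) (f (s j)).

Lemma homo_ltn_step (s : nat -> nat) :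
  (forall i, (s i < s i.+1)%N) -> forall i j, (i < j)%N -> (s i < s j)%N.
Proof. by move=> sS i j; apply: (homo_ltn (r := fun i j => i < j)%N ltn_trans sS). Qed.

Lemma leq_well_quasi_order : well_quasi_order leq.
Proof.
move=> f.
have exg N : exists i, (N <= i)%N /\ forall j, (N <= j)%N -> (f i <= f j)%N.
  pose Q v := `[< exists2 i, (N <= i)%N & f i = v >].
  have exQ : exists v, Q v by exists (f N); apply/asboolP; exists N.
  case: (ex_minnP exQ) => v /asboolP[i Ni <-] minv; exists i; split=> // j Nj.
  by apply: minv; apply/asboolP; exists j.
have [g gP] := choice exg.
pose s := fix s i := if i is i'.+1 then g (s i').+1 else g 0%N.
have sS i : (s i < s i.+1)%N by have [] := gP (s i).+1.
exists s; split; first exact: homo_ltn_step.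
have s_min i j : (s i <= j)%N -> (f (s i) <= f j)%N.
  case: i => [|i] sij; first by have [_] := gP 0%N; apply.
  by have [_] := gP (s i).+1; apply; apply: leq_trans (sS i) sij.
move=> i j; rewrite leq_eqVlt => /predU1P[->//|ij].
by apply/s_min/ltnW/homo_ltn_step.
Qed.

Lemma prod_well_quasi_order (T U : Type) (R : T -> T -> Prop) (S : U -> U -> Prop) :
  well_quasi_order R -> well_quasi_order S ->
  well_quasi_order (fun x y : T * U => R x.1 y.1 /\ S x.2 y.2).
Proof.
move=> wR wS f; have [s [sI sR]] := wR (fst \o f).
have [r [rI rS]] := wS (snd \o f \o s); exists (s \o r); split=> [i j ij|i j ij].
  exact/sI/rI.
split; last exact: rS.
apply: sR; move: ij; rewrite leq_eqVlt => /predU1P[->//|/rI].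
exact: ltnW.
Qed.

Lemma multinom_well_quasi_order m :
  well_quasi_order (fun a b : 'X_{1..m} => is_true (lem a b)).
Proof.
have aux N (F : nat -> nat -> nat) : exists s : nat -> nat,
    (forall i j, (i < j)%N -> (s i < s j)%N) /\
    forall q, (q < N)%N -> forall i j, (i <= j)%N -> (F q (s i) <= F q (s j))%N.
  elim: N => [|N [s [sI sF]]]; first by exists id.
  have [r [rI rF]] := leq_well_quasi_order (F N \o s).
  exists (s \o r); split=> [i j ij|q]; first exact/sI/rI.
  rewrite ltnS leq_eqVlt => /predU1P[->|qN] i j ij; first exact: rF.
  apply: sF => //; move: ij; rewrite leq_eqVlt => /predU1P[->//|/rI].
  exact: ltnW.
move=> f; have [s [sI sF]] := aux m (fun q i => nth 0%N (f i) q).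
exists s; split=> // i j ij; apply/mnm_lepP => q.
by rewrite !(mnm_nth 0%N); apply: sF.
Qed.

(** Without a finite basis one could choose, again and again, an element of [X]
    that is above none of those chosen before. *)
Lemma finite_basis (T : choiceType) (R : T -> T -> Prop) (X : set T) :
  well_quasi_order R -> exists l : seq T, (forall x, x \in l -> X x) /\
    forall x, X x -> exists y, y \in l /\ R y x.
Proof.
move=> wR; have [//|nb] := pselect (exists l : seq T, (forall x, x \in l -> X x) /\
    forall x, X x -> exists y, y \in l /\ R y x).
have exg (l : seq T) : exists x, (forall y, y \in l -> X y) ->
    X x /\ forall y, y \in l -> ~ R y x.
  have [lX|nlX] := pselect (forall y, y \in l -> X y); last first.
    have [[x _]|nT] := pselect (exists x : T, True); first by exists x.
    by case: nlX => y; case: nT; exists y.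
  have [[x [Xx xl]]|nx] := pselect (exists x, X x /\ forall y, y \in l -> ~ R y x).
    by exists x.
  case: nb; exists l; split=> // x Xx.
  have [//|ny] := pselect (exists y, y \in l /\ R y x).
  by case: nx; exists x; split=> // y yl Ryx; apply: ny; exists y.
have [g gP] := choice exg.
pose L := fix L i := if i is i'.+1 then g (L i') :: L i' else [::].
have LX i : forall y, y \in L i -> X y.
  elim: i => [//|i IHi] y; rewrite inE => /predU1P[->|/IHi //].
  by have [] := gP _ IHi.
have Lg i j : (i < j)%N -> g (L i) \in L j.
  elim: j => [//|j IHj]; rewrite ltnS leq_eqVlt inE => /predU1P[->|/IHj ->].
    by rewrite eqxx.
  by rewrite orbT.
have [s [sI sR]] := wR (g \o L).
have [_ /(_ _ (Lg _ _ (sI 0%N 1%N isT)))] := gP _ (LX (s 1%N)).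
by case; apply: sR.
Qed.

End Dickson.

(** * The action of the monomials *)

Section SigmaMonomials.
Variable n : nat.

Lemma sigma_mon_rel (R S : sigmaRingType n) (K : (R -> R) -> (S -> S) -> Prop) e :
  K idfun idfun -> (forall f g f' g', K f f' -> K g g' -> K (f \o g) (f' \o g')) ->
  (forall j : 'I_n, K (sigma j) (sigma j)) -> K (sigma_mon e) (sigma_mon e).
Proof.
move=> K1 KM Ks; apply: (big_ind2 K) => // [f f' g g' Kf Kg|j _]; first exact: KM.
by elim: (e j) => [//|i IHi]; apply: (KM _ _ _ _ (Ks j) IHi).
Qed.

Section Ring.
Variable R : sigmaRingType n.
Implicit Types (e f : 'I_n -> nat) (x : R).

Lemma sigma_mon_morphism e :
  nmod_morphism (sigma_mon e : R -> R) /\ monoid_morphism (sigma_mon e : R -> R).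
Proof.
pose K (f _ : R -> R) := nmod_morphism f /\ monoid_morphism f.
suff : K (sigma_mon e) (sigma_mon e) by [].
apply: sigma_mon_rel; first by split; split.
- move=> f g f' g' [[f0 fD] [f1 fM]] [[g0 gD] [g1 gM]].
  split; split=> [|x y]; rewrite /= ?g0 ?gD ?g1 ?gM ?f0 ?f1 //.
- by move=> j; split; split; rewrite ?rmorph0 ?rmorph1 //; [apply: rmorphD|apply: rmorphM].
Qed.

HB.instance Definition _ e :=
  GRing.isNmodMorphism.Build R R (sigma_mon e) (sigma_mon_morphism e).1.
HB.instance Definition _ e :=
  GRing.isMonoidMorphism.Build R R (sigma_mon e) (sigma_mon_morphism e).2.

Lemma sigma_mon_comp e f x :
  sigma_mon (fun i => e i + f i)%N x = sigma_mon e (sigma_mon f x).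
Proof.
rewrite /sigma_mon; elim: (index_enum _) x => [|j r IHr] x; first by rewrite !big_nil.
have s1 i m (y : R) : sigma j (iter m (sigma i) y) = iter m (sigma i) (sigma j y).
  by elim: m => [//|m /= <-]; rewrite sigmaC.
have sC m (y : R) : iter m (sigma j) ((\big[comp/idfun]_(i <- r) iter (e i) (sigma i)) y) =
    (\big[comp/idfun]_(i <- r) iter (e i) (sigma i)) (iter m (sigma j) y).
  elim: m => [//|m /= ->]; move: (iter m _ y) => {m y}.
  by elim: r {IHr x} => [|i r IHr] y; rewrite ?big_nil // !big_cons /= s1 IHr.
by rewrite !big_cons /= iterD IHr sC.
Qed.

Lemma sigma_mon0 x : sigma_mon (0%MM : 'X_{1..n}) x = x.
Proof.
rewrite /sigma_mon; elim: (index_enum _) => [|j r IHr]; first by rewrite big_nil.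
by rewrite big_cons /= mnm0E.
Qed.

Lemma sigma_mon1 (j : 'I_n) x : sigma_mon U_(j)%MM x = sigma j x.
Proof.
rewrite /sigma_mon; have := index_enum_uniq 'I_n; have := mem_index_enum j.
suff aux r : uniq r ->
    (\big[comp/idfun]_(i <- r) iter (U_(j)%MM i) (sigma i)) x =
    if j \in r then sigma j x else x.
  by move=> jr /aux ->; rewrite jr.
elim: r => [|i r IHr] /=; first by rewrite big_nil.
move=> /andP[ir /IHr]; rewrite big_cons /= mnm1E inE => ->.
by case: eqVneq => [->|_] //=; rewrite (negPf ir).
Qed.

End Ring.
End SigmaMonomials.

(** * Generated Hopf subalgebras and their augmentation ideals *)

Section Generated.
Variable k : fieldType.

Section Algebra.
Variable A : comAlgType k.
Implicit Types G C : set A.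

Lemma generated_subalgP G : subalgebra (generated_subalg G).
Proof.
apply/subalg_closedP; split=> [|c x y|x y]; rewrite ?unfold_in ?in_setE.
- by move=> M [[M1 _ _] _]; rewrite -in_setE.
- move=> Gx Gy M [sM GM]; have [_ sbM _] := (subalg_closedP M).1 sM.
  by apply: sbM.2; [apply: Gx|apply: Gy].
- move=> Gx Gy M [sM GM]; have [_ _ MM] := (subalg_closedP M).1 sM.
  by apply: MM; [apply: Gx|apply: Gy].
Qed.

Lemma generated_subalg_sub G x : G x -> generated_subalg G x.
Proof. by move=> Gx M [_]; apply. Qed.

Lemma generated_subalg_min G C : subalgebra C -> (forall x, G x -> C x) ->
  forall x, generated_subalg G x -> C x.
Proof. by move=> /subalg_closedP sC GC x; apply. Qed.

Lemma subalgebra_alg C (c : k) : subalgebra C -> C c%:A.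
Proof. by case=> C1 subC _; apply: subspaceZ. Qed.

End Algebra.

Variable A : hopfAlgType k.
Implicit Types G C : set A.

Lemma generated_hopf_subalgebra G :
  (forall g, G g -> tspan (fun a b => generated_subalg G a /\ generated_subalg G b) (comul g)) ->
  (forall g, G g -> generated_subalg G (antipode g)) ->
  hopf_subalgebra (generated_subalg G).
Proof.
move=> GD GS; have sG := generated_subalgP G; have [G1 subG GM] := sG.
pose GG a b := generated_subalg G a /\ generated_subalg G b.
split; first exact/subalg_closedP.
- apply: (@generated_subalg_min A G
    [set x | tspan GG (comul x)]) => //.
  split=> [||x y xP yP] /=; rewrite ?rmorph1 ?rmorphM.
  + exact: (tspan_tens (P := GG) (conj G1 G1)).
  + have sT : subspace (tspan GG).
      by apply: tspan_subspace => c a b [Ga Gb]; split=> //; apply: (subspaceZ subG).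
    split=> [|c x y xP yP] /=; first by rewrite linear0; apply: tspan0.
    by rewrite linearP; apply: sT.2.
  + by apply: tspan_mul xP yP => a b a' b' [? ?] [? ?]; split; apply: GM.
- apply: (@generated_subalg_min A G [set x | generated_subalg G (antipode x)]) => //.
  split=> [||x y xP yP] /=; rewrite ?rmorph1 ?rmorphM //; last exact: GM.
  split=> [|c x y xP yP] /=; first by rewrite linear0; apply: subspace0.
  by rewrite linearP; apply: subG.2.
Qed.

Lemma counit_antipode (x : A) : counit (antipode x) = counit x.
Proof.
rewrite -[in LHS](conv_cstl (antipode : {linear A -> A})).
have := congr1 counit (conv_antipoder (idfun : {lrmorphism A -> A}) x).
rewrite /cst counit_alg => <-; rewrite /conv /tprod /tensor_lift !linear_sum.
apply: eq_bigr => p _; rewrite /= !rmorphM; congr (_ * _); exact: counit_alg.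
Qed.

(** The coproduct of an [x] of counit [0] in [C] has no component in [k (x) k]. *)
Lemma aug_hopf_ideal C : hopf_subalgebra C -> hopf_ideal (aug C).
Proof.
move=> hC; have [/subalg_closedP[C1 subC _] CD CS] := hC.
have iC := aug_ideal C.
have aug1 x : C x -> counit x = 0 -> aug C x.
  by move=> Cx ex; rewrite -[x]mulr1; apply: aug_mem.
split=> //.
- apply: (@aug_ind _ _ C [set x | counit x = 0]) => //; split=> [|a x /= ex].
    split=> [|c x y /= ex ey]; first by rewrite /= rmorph0.
    by rewrite linearP /= ex ey mulr0 addr0.
  by rewrite rmorphM /= ex mulr0.
- apply: (@aug_ind _ _ C [set x | aug C (antipode x)]) => [|x Cx ex] /=; last first.
    by apply: aug1; [apply: CS|rewrite counit_antipode].
  split=> [|a x /= aS]; last by rewrite rmorphM; apply: iC.2.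
  split=> [|c x y /= xS yS]; first by rewrite /= linear0; apply: subspace0 iC.1.
  by rewrite linearP; apply: iC.1.2.
have sT : subspace (tor (aug C)).
  by apply: tspan_subspace => c a b [] ?; [left; apply: (subspaceZ iC.1)|right].
apply: (@aug_ind _ _ C [set x | tor (aug C) (comul x)]) => [|x Cx ex] /=.
  split=> [|a x /= xP]; last by rewrite rmorphM; apply: tor_mul.
  split=> [|c x y /= xP yP]; first by rewrite /= linear0; apply: subspace0.
  by rewrite linearP; apply: sT.2.
have [|H HE] := @exists_linear k _ _ (fun t =>
    t - tprod (cst (tensor A A) counit) (cst (tensor A A) counit) t).
  by move=> c s t; rewrite !linearP addrACA scalerDr.
have : tor (aug C) (H (comul x)).
  have Cx2 : tspan (fun a b => C a /\ C b) (comul x) by apply: CD.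
  apply: (tspan_ind (M := tor (aug C)) _ _ _ Cx2).
  - exact: subspace0.
  - by move=> s t; apply: subspaceD.
  - have augB a : C a -> aug C (a - (counit a)%:A).
      move=> Ca; apply: aug1; last by rewrite rmorphB /= counit_alg subrr.
      by apply: subspaceB => //; apply: subspaceZ.
    move=> a b [Ca Cb]; rewrite HE tprodE /= /cst.
    have -> : a *t b - (counit a)%:A * (counit b)%:A =
        (a - (counit a)%:A) *t b + (counit a)%:A *t (b - (counit b)%:A).
      have -> : (counit a)%:A * (counit b)%:A = (counit a)%:A *t (counit b)%:A :> tensor A A.
        by rewrite -scalerAl mul1r -[RHS]tensZl -[X in _ = _ *: X]tensZ -tensZl.
      set ca := (counit a)%:A; set cb := (counit b)%:A.
      have -> : a *t b = (a - ca) *t b + ca *t b by rewrite -tensDl subrK.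
      have -> : ca *t b = ca *t (b - cb) + ca *t cb by rewrite -tensDr subrK.
      by rewrite addrA addrK.
    by apply: tspanD; apply: tspan_tens; [left|right]; apply: augB.
rewrite HE (_ : tprod _ _ _ = 0) ?subr0 //.
transitivity (conv (cst (tensor A A) counit) (cst (tensor A A) counit) x) => //.
transitivity (cst (tensor A A) counit x); first exact: conv_cstl.
by rewrite /cst ex scale0r.
Qed.

End Generated.

Section SigmaHopf.
Variables (n : nat) (k : sigmaFieldType n) (A : sigmaHopfType k).
Implicit Types (e : 'I_n -> nat) (B : set A) (P Q : set 'X_{1..n}).

Lemma sigma_mon_lin e (c : k) (x y : A) :
  sigma_mon e (c *: x + y) = sigma_mon e c *: sigma_mon e x + sigma_mon e y.
Proof.
rewrite rmorphD; congr (_ + _).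
pose K (f : k -> k) (g : A -> A) := forall c x, g (c *: x) = f c *: g x.
suff : K (sigma_mon e) (sigma_mon e) by apply.
apply: sigma_mon_rel => [//|f g f' g' Kf Kg d z /=|j d z].
  by rewrite Kg Kf.
exact: sigmaZ.
Qed.

Lemma sigma_mon_tens e (a b : A) :
  sigma_mon e (a *t b) = sigma_mon e a *t sigma_mon e b.
Proof.
pose K (f : A -> A) (g : tensor A A -> tensor A A) :=
  forall a b, g (a *t b) = f a *t f b.
suff : K (sigma_mon e) (sigma_mon e) by apply.
apply: sigma_mon_rel => [//|f g f' g' Kf Kg d z /=|j d z].
  by rewrite Kg Kf.
exact: sigma_tens.
Qed.

Lemma sigma_mon_commute (R S : sigmaRingType n) (h : R -> S) e x :
  sigma_morphism h -> h (sigma_mon e x) = sigma_mon e (h x).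
Proof.
move=> hs; pose K (f : R -> R) (g : S -> S) := forall x, h (f x) = g (h x).
suff : K (sigma_mon e) (sigma_mon e) by apply.
by apply: sigma_mon_rel => [//|f g f' g' Kf Kg y /=|j y]; rewrite ?Kf ?Kg.
Qed.

Lemma sigma_mon_stable B e : (forall (j : 'I_n) b, B b -> B (sigma j b)) ->
  forall b, B b -> B (sigma_mon e b).
Proof.
move=> Bs; pose K (f _ : A -> A) := forall b, B b -> B (f b).
suff : K (sigma_mon e) (sigma_mon e) by [].
by apply: sigma_mon_rel => [//|f g f' g' Kf Kg b Bb|j b]; [apply/Kf/Kg|apply: Bs].
Qed.

Lemma sigma_mon_tspan e (P Q : A -> A -> Prop) (t : tensor A A) :
  (forall a b, P a b -> Q (sigma_mon e a) (sigma_mon e b)) ->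
  tspan P t -> tspan Q (sigma_mon e t).
Proof.
move=> PQ [s [sP ->]]; exists [seq (sigma_mon e p.1, sigma_mon e p.2) | p <- s]; split.
  by move=> _ /mapP[p /sP Pp ->]; apply: PQ.
by rewrite rmorph_sum big_map; apply: eq_bigr => p _; rewrite /= sigma_mon_tens.
Qed.

Definition translates (P : set 'X_{1..n}) (G : seq A) : set A :=
  [set x | exists (e : 'X_{1..n}) g, [/\ P e, g \in G & x = sigma_mon e g]].

Definition layer P G : set A := generated_subalg (translates P G).

Definition hopf_closed (G : seq A) : Prop :=
  (forall g, g \in G -> tspan (fun a b => a \in G /\ b \in G) (comul g)) /\
  (forall g, g \in G -> antipode g \in G).

Lemma layer_mem (P : set 'X_{1..n}) G (e : 'X_{1..n}) g : P e -> g \in G -> layer P G (sigma_mon e g).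
Proof. by move=> Pe gG; apply: generated_subalg_sub; exists e, g. Qed.

Lemma layer_hopf P G : hopf_closed G -> hopf_subalgebra (layer P G).
Proof.
move=> [GD GS]; apply: generated_hopf_subalgebra => _ [e [g [Pe gG ->]]].
  rewrite sigma_mon_commute; last exact: comul_sigma.
  by apply: sigma_mon_tspan (GD g gG) => a b [aG bG]; split; apply: layer_mem.
rewrite sigma_mon_commute; last exact: antipode_sigma.
by apply: layer_mem => //; apply: GS.
Qed.

Lemma layer_le (P Q : set 'X_{1..n}) G :
  (forall a, P a -> Q a) -> forall x, layer P G x -> layer Q G x.
Proof.
move=> PQ; apply: generated_subalg_min; first exact: generated_subalgP.
by move=> _ [e [g [/PQ Qe gG ->]]]; apply: layer_mem.
Qed.

Lemma layer_shift (P Q : set 'X_{1..n}) G (rho : 'X_{1..n}) :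
  (forall a, P a -> Q (rho + a)%MM) ->
  forall x, layer P G x -> layer Q G (sigma_mon rho x).
Proof.
move=> PQ; have [L1 subL LM] := generated_subalgP (translates Q G).
apply: (@generated_subalg_min _ A (translates P G) [set x | layer Q G (sigma_mon rho x)]).
  split=> [||x y xL yL] /=; rewrite ?rmorph1 ?rmorphM //; last exact: LM.
  split=> [|c x y xL yL] /=; first by rewrite rmorph0; apply: subspace0.
  by rewrite sigma_mon_lin; apply: subL.2.
move=> _ [e [g [/PQ Qe gG ->]]] /=; rewrite -sigma_mon_comp.
have -> : (fun i => rho i + e i)%N = (rho + e)%MM :> ('I_n -> nat).
  by apply/funext => i; rewrite mnmDE.
exact: layer_mem.
Qed.

End SigmaHopf.

(** * Leading monomials *)

Section LeadingMonomials.
Variables (n : nat) (k : sigmaFieldType n) (A : sigmaHopfType k) (G : seq A).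
Hypothesis hG : hopf_closed G.

Notation N := (size G).
Implicit Types (tau rho : 'X_{1..n}) (al be ga : 'X_{1..N}) (I J : set A).
Implicit Types (P Q : set 'X_{1..N}).

Definition lower tau : set A := layer [set a | (a < tau)%O] G.
Definition upto tau : set A := layer [set a | (a <= tau)%O] G.

Definition mon tau al : A := \prod_(i < N) sigma_mon tau (tnth (in_tuple G) i) ^+ al i.

Definition lin tau P : set A := [set x | exists s : seq (k * 'X_{1..N}),
  (forall p, p \in s -> P p.2) /\ x = \sum_(p <- s) p.1 *: mon tau p.2].

Lemma monD tau al be : mon tau (al + be)%MM = mon tau al * mon tau be.
Proof. by rewrite -big_split; apply: eq_bigr => i _; rewrite mnmDE exprD. Qed.

Lemma mon0 tau : mon tau 0%MM = 1.
Proof. by rewrite /mon big1 // => i _; rewrite mnm0E expr0. Qed.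

Lemma mon1 tau i : mon tau U_(i)%MM = sigma_mon tau (tnth (in_tuple G) i).
Proof.
rewrite /mon (bigD1 i) //= mnm1E eqxx expr1 big1 ?mulr1 // => j /negPf ji.
by rewrite mnm1E eq_sym ji expr0.
Qed.

Lemma sigma_mon_mon rho tau al : sigma_mon rho (mon tau al) = mon (rho + tau)%MM al.
Proof.
rewrite rmorph_prod; apply: eq_bigr => i _; rewrite rmorphXn /= -sigma_mon_comp.
congr (sigma_mon _ _ ^+ _).
by apply/funext => j; rewrite mnmDE.
Qed.

Lemma lin_subspace tau P : subspace (lin tau P).
Proof.
split=> [|c _ _ [s [sP ->]] [s' [sP' ->]]]; first by exists [::]; rewrite big_nil.
exists ([seq (c * p.1, p.2) | p <- s] ++ s'); split.
  by move=> p; rewrite mem_cat => /orP[/mapP[q /sP ? ->]|/sP'].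
rewrite big_cat big_map /= scaler_sumr; congr (_ + _).
by apply: eq_bigr => p _; rewrite scalerA.
Qed.

Lemma lin_mon tau P al : P al -> lin tau P (mon tau al).
Proof.
move=> Pal; exists [:: (1, al)]; rewrite big_seq1 scale1r; split=> // p.
by rewrite inE => /eqP ->.
Qed.

Lemma lin_ind tau P (X : set A) : subspace X -> (forall al, P al -> X (mon tau al)) ->
  forall x, lin tau P x -> X x.
Proof.
move=> sX PX x [s [sP ->]]; apply: subspace_sum_seq => // p /sP Pp.
by apply: subspaceZ => //; apply: PX.
Qed.

Lemma lin_leading tau P x : lin tau P x -> x = 0 \/
  exists be, P be /\ exists c q, lin tau [set ga | (ga < be)%O] q /\ x = c *: mon tau be + q.
Proof.
case=> s [sP ->] {x}; elim: s sP => [|[c ga] s IHs] sP; first by left; rewrite big_nil.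
right; rewrite big_cons /=; have Pga : P ga := sP _ (mem_head _ _).
have [|->|[be [Pbe [d [q [qlin ->]]]]]] := IHs.
- by move=> p ps; apply: sP; rewrite inE ps orbT.
- by exists ga; split=> //; exists c, 0; split=> //; apply: subspace0 (lin_subspace _ _).
have lin_le al al' r : (al <= al')%O -> lin tau [set ga | (ga < al)%O] r ->
    lin tau [set ga | (ga < al')%O] r.
  move=> le [t [tP ->]]; exists t; split=> // p /tP /= lt; exact: lt_le_trans le.
case: (ltgtP ga be) => [lt|gt|eq].
- exists be; split=> //; exists d, (c *: mon tau ga + q); split; last by rewrite addrCA.
  by apply: (lin_subspace _ _).2 => //; apply: lin_mon.
- exists ga; split=> //; exists c, (d *: mon tau be + q); split=> //.
  apply: (lin_subspace _ _).2; first exact: lin_mon.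
  by apply: lin_le qlin; apply: ltW.
- exists be; split=> //; exists (c + d), q; split=> //.
  by rewrite eq addrA scalerDl.
Qed.

(** Modulo [aug (lower tau)] the elements of [lower tau] are constants, so only
    polynomials in the translates by [tau] remain. *)
Lemma upto_lin tau x : upto tau x -> addset (lin tau setT) (aug (lower tau)) x.
Proof.
have sL := lin_subspace tau setT; have [sI IM] := aug_ideal (lower tau).
have [L1 subL _] : subalgebra (lower tau) by apply: generated_subalgP.
have lin1 : lin tau setT 1 by rewrite -(mon0 tau); apply: lin_mon.
apply: generated_subalg_min.
  split; last 1 first.
  - move=> _ _ [p [a [pL aI ->]]] [q [b [qL bI ->]]].
    exists (p * q), (p * b + (q + b) * a); split; last 1 first.
    + by rewrite mulrDl mulrDr [a * _]mulrC addrA.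
    + move: p pL; apply: lin_ind => [|al _].
        split=> [|c u v uP vP] /=; first by rewrite mul0r; apply: subspace0.
        by rewrite mulrDl -scalerAl; apply: sL.2.
      move: q qL; apply: lin_ind => [|be _].
        split=> [|c u v uP vP] /=; first by rewrite mulr0; apply: subspace0.
        by rewrite mulrDr -scalerAr; apply: sL.2.
      by rewrite -monD; apply: lin_mon.
    + by apply: subspaceD => //; apply: IM.
  - by exists 1, 0; rewrite addr0; split=> //; apply: subspace0.
  - exact: addset_subspace.
move=> _ [e [g [/= le gG ->]]]; move: le; rewrite le_eqVlt => /predU1P[->|lt].
  have /tnthP[i ->] : g \in in_tuple G := gG.
  exists (mon tau U_(i)%MM), 0; rewrite addr0 mon1; split=> //.
    by rewrite -mon1; apply: lin_mon.
  exact: subspace0.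
have Lx : lower tau (sigma_mon e g) by apply: layer_mem.
exists (counit (sigma_mon e g))%:A, (sigma_mon e g - (counit (sigma_mon e g))%:A).
split; [exact: (subspaceZ sL)| |by rewrite addrC subrK].
rewrite -[_ - _]mulr1; apply: aug_mem; last by rewrite rmorphB /= counit_alg subrr.
by apply: (subspaceB subL) => //; apply: (subspaceZ subL).
Qed.

(** Modulo [aug (lower tau)], which amounts to passing to the kernel of the
    projection that forgets the translates by [tau], some elements of [I] become
    polynomials in the translates by [tau]; the [al] with [lead I (tau, al)] are
    the leading monomials of these. *)
Definition lead I (p : 'X_{1..n} * 'X_{1..N}) : Prop :=
  exists F q, [/\ I F, lin p.1 [set ga | (ga < p.2)%O] q &
    aug (lower p.1) (F - (mon p.1 p.2 + q))].

(** Acting by a monomial moves [tau] and multiplying by a monomial moves [al];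
    both preserve the order on monomials, hence leading monomials. *)
Lemma lead_up I (p p' : 'X_{1..n} * 'X_{1..N}) :
  ideal I -> (forall (j : 'I_n) b, I b -> I (sigma j b)) ->
  lem p.1 p'.1 -> lem p.2 p'.2 -> lead I p -> lead I p'.
Proof.
case: p p' => [tau al] [tau' al'] [_ IM] Isigma /= /submK <- /submK <-.
set rho := (tau' - tau)%MM; set ga := (al' - al)%MM => -[F [q [IF ql Fq]]].
exists (mon (rho + tau)%MM ga * sigma_mon rho F), (mon (rho + tau)%MM ga * sigma_mon rho q).
split=> /=.
- by apply: IM; apply: (@sigma_mon_stable _ _ _ I).
- move: q ql {Fq}; apply: lin_ind => [|be /= lt].
    have sL := lin_subspace (rho + tau)%MM [set be | (be < (ga + al)%MM)%O].
    split=> [|c x y xP yP]; first by rewrite /= rmorph0 mulr0; apply: (subspace0 sL).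
    by rewrite /= sigma_mon_lin mulrDr -scalerAr; apply: sL.2.
  by rewrite sigma_mon_mon -monD; apply: lin_mon; rewrite /= ltmc_add2r.
- rewrite monD -(sigma_mon_mon rho tau al) -mulrDr -mulrBr -rmorphD -rmorphB /=.
  apply: (aug_ideal _).2; case: Fq => s [sP ->].
  rewrite rmorph_sum; exists [seq (sigma_mon rho p.1, sigma_mon rho p.2) | p <- s].
  split; last by rewrite big_map; apply: eq_bigr => p _; rewrite /= rmorphM.
  move=> _ /mapP[p /sP[pl pe] ->] /=; split.
    by apply: layer_shift pl => e /= lt; rewrite ltmc_add2r.
  by rewrite sigma_mon_commute ?pe ?rmorph0 //; apply: counit_sigma.
Qed.

(** An element involves finitely many translates, the largest of which bounds it. *)
Lemma layer_bounded (P : set 'X_{1..n}) x : layer P G x ->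
  (exists c, x = c%:A) \/ exists2 tau, P tau & upto tau x.
Proof.
have uptoA tau c : upto tau c%:A.
  exact: (@subalgebra_alg _ A (upto tau) c (generated_subalgP _)).
have upto_le tau tau' y : (tau <= tau')%O -> upto tau y -> upto tau' y.
  by move=> le; apply: layer_le => e /= /le_trans; apply.
pose Z : set A := [set x | (exists c, x = c%:A) \/ exists2 tau, P tau & upto tau x].
have bin (op : A -> A -> A) :
    (forall c d, exists e, op c%:A d%:A = e%:A) ->
    (forall tau y z, upto tau y -> upto tau z -> upto tau (op y z)) ->
    forall y z, Z y -> Z z -> Z (op y z).
  move=> opA opU y z [[c ->]|[tau Pt yt]] [[d ->]|[tau' Pt' zt]].
  - by left; have [e ->] := opA c d; exists e.
  - by right; exists tau' => //; apply: opU.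
  - by right; exists tau => //; apply: opU.
  right; have [le|/ltW le] := leP tau tau'; [exists tau'|exists tau] => //; apply: opU => //.
    exact: upto_le yt.
  exact: upto_le zt.
apply: (@generated_subalg_min _ A (translates P G) Z); last first.
  by move=> _ [e [g [Pe gG ->]]]; right; exists e => //; apply: layer_mem; rewrite /=.
split; first by left; exists 1; rewrite scale1r.
  split=> [|c]; first by left; exists 0; rewrite scale0r.
  apply: (bin (fun y z => c *: y + z)) => [a b|tau y z].
    by exists (c * a + b); rewrite scalerDl scalerA.
  by have [_ sU _] := generated_subalgP (translates [set a | (a <= tau)%O] G); apply: sU.2.
apply: (bin *%R) => [a b|tau y z].
  by exists (a * b); rewrite -scalerAl mul1r scalerA.
by have [_ _ sU] := generated_subalgP (translates [set a | (a <= tau)%O] G); apply: sU.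
Qed.

Section Division.
Variables (I J : set A) (tau : 'X_{1..n}).
Hypotheses (iI : ideal I) (iJ : ideal J) (JI : forall x, J x -> I x).
Hypothesis leadIJ : forall al, lead I (tau, al) -> lead J (tau, al).

(** Subtracting multiples of elements of [J] lowers the leading monomial of [x]
    until nothing is left modulo [aug (lower tau)]. *)
Lemma division x : upto tau x -> I x -> addset J (aug (lower tau)) x.
Proof.
have [subI _] := iI; have [subJ _] := iJ; have [subU _] := aug_ideal (lower tau).
have subR := addset_subspace subJ subU.
have sL P := lin_subspace tau P.
pose claim be := forall c y q, I y -> lin tau [set ga | (ga < be)%O] q ->
  aug (lower tau) (y - (c *: mon tau be + q)) -> addset J (aug (lower tau)) y.
have by_leading P : (forall be, P be -> claim be) -> forall y q, I y -> lin tau P q ->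
    aug (lower tau) (y - q) -> addset J (aug (lower tau)) y.
  move=> Pclaim y q Iy /lin_leading[->|[be [Pbe [c [r [rl ->]]]]]]; last exact: Pclaim.
  by rewrite subr0 => yU; exists 0, y; rewrite add0r; split=> //; apply: subspace0.
have claimP be : claim be.
  elim/(@ltmwf N): be => be IH c y q Iy ql; have strict := by_leading _ IH.
  have [->|c0] := eqVneq c 0; first by rewrite scale0r add0r; apply: strict.
  move=> yU; have [|F [r [JF rl FU]]] := leadIJ (al := be).
    exists (c^-1 *: y), (c^-1 *: q); split=> /=.
    - exact: subspaceZ.
    - exact: subspaceZ.
    - rewrite -[mon tau be]scale1r -(mulVf c0) -scalerA -scalerDr -scalerBr.
      exact: subspaceZ.
  have -> : y = (y - c *: F) + c *: F by rewrite subrK.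
  apply: subspaceD => //.
    apply: (strict (y - c *: F) (q - c *: r)).
    - by apply: subspaceB => //; apply: subspaceZ => //; apply: JI.
    - by apply: subspaceB => //; apply: subspaceZ.
    have -> : y - c *: F - (q - c *: r) =
        (y - (c *: mon tau be + q)) - c *: (F - (mon tau be + r)).
      rewrite scalerBr scalerDr !opprD !opprK.
      by rewrite [RHS]addrACA [X in _ = _ + X]addrACA addNr add0r.
    by apply: subspaceB => //; apply: subspaceZ.
  exists (c *: F), 0; rewrite addr0; split=> //; last exact: subspace0.
  exact: subspaceZ.
move=> /upto_lin[q [a [ql aU ->]]] Ix.
by apply: (by_leading setT _ _ q) => //; rewrite addrC addKr.
Qed.

End Division.

(** Induction on [tau]: below [tau] the two ideals agree, so the two groups have
    the same image under the projection that forgets the translates by [tau];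
    by division they have the same kernel there. *)
Lemma hopf_ideal_eq_lead I J : hopf_ideal I -> hopf_ideal J ->
  (forall x, J x -> I x) -> (forall p, lead I p -> lead J p) ->
  forall tau x, upto tau x -> I x -> J x.
Proof.
move=> hI hJ JI leadIJ; elim/(@ltmwf n) => tau IH x.
have [iI Ie _ _] := hI; have [iJ _ _ _] := hJ.
apply: (hopf_ideal_descent (D := lower tau)) => //; try exact: layer_hopf.
- move=> y /layer_bounded[[c ->]|[tau' /= lt yt]]; last exact: IH yt.
  by move=> /Ie; rewrite counit_alg => ->; rewrite scale0r; apply: subspace0 iJ.1.
- by move=> y; apply: division => // al; apply: leadIJ.
Qed.

End LeadingMonomials.

(** * Finite generation of Hopf subalgebras *)

Section FiniteGeneration.
Variables (n : nat) (k : sigmaFieldType n) (A : sigmaHopfType k).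

Lemma hopf_closed_generators : finitely_sigma_generated [set: A] ->
  exists G : seq A, hopf_closed G /\ forall x, layer setT G x.
Proof.
move=> [F [/finite_seqP[L ->] _ AE]].
have [//|G [_ GD GS GL]] := finite_hopf_hull (L := L) (@hopf_subalgebraT _ A).
exists G; split=> // x; have : [set: A] x by [].
have sG := generated_subalgP (translates setT G); have [G1 subG GM] := sG.
rewrite AE; apply: generated_subalg_min => // _ [e _ [f /= fL <-]].
have <- : [multinom e i | i < n] = e :> ('I_n -> nat).
  by apply/funext => i; rewrite mnmE.
apply: (GL [set f | layer setT G (sigma_mon [multinom e i | i < n] f)]) fL.
  split=> [|c y z yP zP]; first by rewrite /= rmorph0; apply: subspace0.
  by rewrite /= sigma_mon_lin; apply: subG.2.
by move=> g gG; apply: layer_mem.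
Qed.

Lemma layer_sigma (G : seq A) (j : 'I_n) x : layer setT G x -> layer setT G (sigma j x).
Proof.
by rewrite -sigma_mon1; apply: layer_shift.
Qed.

Lemma aug_sigma (C : set A) : (forall (j : 'I_n) b, C b -> C (sigma j b)) ->
  forall (j : 'I_n) b, aug C b -> aug C (sigma j b).
Proof.
move=> Cs j _ [s [sC ->]]; rewrite rmorph_sum.
exists [seq (sigma j p.1, sigma j p.2) | p <- s]; split.
  move=> _ /mapP[p /sC[Cp ep] ->] /=; split; first exact: Cs.
  by rewrite (counit_sigma j p.1) /= ep rmorph0.
by rewrite big_map; apply: eq_bigr => p _; rewrite /= rmorphM.
Qed.

(** An element of [aug B] is expressed with finitely many elements of [B], and it
    lies in [aug C] as soon as [C] contains those. *)
Lemma finite_lead_witness (B : set A) (G : seq A) (l : seq ('X_{1..n} * 'X_{1..size G})) :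
  (forall p, p \in l -> lead (aug B) p) ->
  exists L : seq A, (forall x, x \in L -> B x) /\ forall C : set A,
    (forall x, x \in L -> C x) -> forall p, p \in l -> lead (aug C) p.
Proof.
elim: l => [|p l IHl] lB; first by exists [::].
have [|L [LB LC]] := IHl; first by move=> q ql; apply: lB; rewrite inE ql orbT.
have [F [q [[s [sB FE]] ql Fq]]] := lB p (mem_head _ _).
exists ([seq u.1 | u <- s] ++ L); split=> [x|C CL r].
  by rewrite mem_cat => /orP[/mapP[u /sB[? _] ->]|/LB].
rewrite inE => /predU1P[->|rl]; last first.
  by apply: LC rl => x xL; apply: CL; rewrite mem_cat xL orbT.
exists F, q; split=> //; exists s; split=> // u us; split; last by have [] := sB u us.
by apply: CL; rewrite mem_cat map_f.
Qed.

End FiniteGeneration.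

Theorem theorem6p9 (n : nat) (n_ge1 : (1 <= n)%N) (k : sigmaFieldType n)
    (A : sigmaHopfType k) (B : set A) :
  finitely_sigma_generated [set: A] ->
  sigma_hopf_subalgebra B ->
  finitely_sigma_generated B.
Proof.
move=> /hopf_closed_generators[G [hG Gall]] [hB Bs].
(* [I = aug B] has finitely many minimal leading monomials, and these are leading
   monomials of [aug C] already for a finitely generated [C] inside [B]. *)
have [l [lB basis]] := finite_basis (@lead n k A G (aug B))
  (prod_well_quasi_order (@multinom_well_quasi_order n) (@multinom_well_quasi_order (size G))).
have [L [LB LC]] := finite_lead_witness lB.
have [H [HB HD HS HL]] := finite_hopf_hull hB LB.
pose C := layer setT H.
have hC : hopf_subalgebra C by apply: layer_hopf.
have [_ subC _] : subalgebra C by apply: generated_subalgP.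
have CB x : C x -> B x.
  apply: generated_subalg_min; first by apply/subalg_closedP; case: hB.
  move=> _ [e [g [_ gH ->]]]; apply: sigma_mon_stable => //; exact: HB.
have CL x : x \in L -> C x.
  apply: HL => // g gH; rewrite -[g]sigma_mon0; exact: layer_mem.
have BC x : B x -> C x.
  apply: hopf_subalgebra_descent => // {}x Bx ex.
  have [[c xE]|[tau _ xtau]] := layer_bounded (Gall x).
    by move: ex; rewrite xE counit_alg => ->; rewrite scale0r; apply: subspace0 (aug_ideal C).1.
  apply: (hopf_ideal_eq_lead hG (aug_hopf_ideal hB) (aug_hopf_ideal hC)) xtau _.
  - by move=> y; apply: (@aug_le _ _ C).
  - move=> p /basis[q [ql [qp1 qp2]]].
    apply: (lead_up (aug_ideal C) (aug_sigma _) qp1 qp2 (LC C CL q ql)).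
    exact: layer_sigma.
  - by rewrite -[x]mulr1; apply: aug_mem.
exists [set` H]; split=> //; first exact: finite_seq.
have -> : [set sigma_mon e f | e in [set: 'I_n -> nat] & f in [set` H]] = translates setT H.
  apply/seteqP; split=> x /= [e]; last first.
    by case=> f [_ fH ->]; exists e => //; exists f.
  move=> _ [f fH <-]; exists [multinom e i | i < n], f; split=> //.
  congr (sigma_mon _ _).
  by apply/funext => i; rewrite mnmE.
by apply/seteqP; split.
Qed.
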